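(* Let $x,y$ be indeterminates, and take $Z_0(x,y)=1$. For every integer $n\ge 2$, the unrefined ASM generating function satisfies (as an identity of rational functions in $x,y$) $$\begin{aligned} Z_n(x,y)={}&Z_{n-1}(x,y)\Biggl(1+\sum_{i=0}^{n-2}\Biggl(y^{i+1}\binom{n-1}{i+1}^2\\ &+\frac{x\,y^i\Bigl(\sum_{j=0}^{n-i-2}\binom{n-j-2}{i}Z_{n-i-1}(x,y)_j\Bigr)^2-y^{i+1}\Bigl(\sum_{j=0}^{n-i-2}\binom{n-j-1}{i+1}Z_{n-i-1}(x,y)_j\Bigr)^2}{Z_{n-i-1}(x,y)\,Z_{n-i-2}(x,y)}\Biggr)\Biggr). \end{aligned}$$
   Context: An alternating sign matrix (ASM) is a square matrix with entries in $\{0,1,-1\}$ such that along each row and each column the nonzero entries alternate in sign and sum to $1$. $\mathrm{ASM}(n)$ is the set of $n\times n$ ASMs. The first row of an ASM contains exactly one $1$, all other entries there being $0$. For $A\in\mathrm{ASM}(n)$ define: $\nu(A)=\sum_{1\le i<i'\le n,\;1\le j'\le j\le n}A_{ij}A_{i'j'}$ (a nonnegative integer); $\mu(A)=$ number of $-1$'s in $A$; $\rho_{\mathrm T}(A)=$ number of $0$'s to the left of the $1$ in the top row. For $n\ge1$: $Z_n(x,y;z)=\sum_{A\in\mathrm{ASM}(n)}x^{\nu(A)}y^{\mu(A)}z^{\rho_{\mathrm T}(A)}$; $Z_n(x,y)=Z_n(x,y;1)$; and $Z_n(x,y)_k$ denotes the coefficient of $z^k$ in $Z_n(x,y;z)$.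 *)

(* Defs.v *)
From mathcomp Require Import all_boot all_order all_algebra.
From mathcomp Require Import mpoly.
Set Implicit Arguments.
Unset Strict Implicit.
Unset Printing Implicit Defensive.
Import Order.TTheory GRing.Theory Num.Theory.
Local Open Scope ring_scope.

(* [seq_sub] makes the entry set {0, 1, -1} a finite type, so that n x n
   matrices over it form a finite type and ASM(n) can be summed over. *)
Definition asm_entry : finType := seq_sub [:: 0; 1; -1 : int].

Definition int_mx n (A : 'M[asm_entry]_n) : 'M[int]_n :=
  \matrix_(i, j) ssval (A i j).

Definition alternating (s : seq int) : bool :=
  sorted (fun a b => a * b < 0) [seq a <- s | a != 0].

Definition asm_line (s : seq int) : bool :=
  alternating s && (\sum_(a <- s) a == 1).

Definition is_asm n (A : 'M[int]_n) : bool :=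
  [forall i, asm_line [seq A i j | j <- enum 'I_n]] &&
  [forall j, asm_line [seq A i j | i <- enum 'I_n]].

Definition ASM n : {set 'M[asm_entry]_n} := [set A | is_asm (int_mx A)].

Definition nu n (A : 'M[int]_n) : int :=
  \sum_(i < n) \sum_(i' < n | (i < i')%N)
    \sum_(j < n) \sum_(j' < n | (j' <= j)%N) A i j * A i' j'.

Definition mu n (A : 'M[int]_n) : nat :=
  #|[set ij : 'I_n * 'I_n | A ij.1 ij.2 == -1]|.

(* The row index t ranges over the (at most one) top row, so that the
   definition also covers n = 0. *)
Definition rhoT n (A : 'M[int]_n) : nat :=
  #|[set j : 'I_n | [exists t : 'I_n, exists k : 'I_n,
      [&& t == 0%N :> nat, (j < k)%N, A t k == 1 & A t j == 0]]]|.

Lemma alternating_sum (a : int) (s : seq int) :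
  all (fun b => (b == 1) || (b == -1)) (a :: s) ->
  sorted (fun b c => b * c < 0) (a :: s) ->
  \sum_(b <- a :: s) b = 0 \/ \sum_(b <- a :: s) b = a.
Proof.
elim: s a => [|b s IH] a; first by rewrite big_seq1; right.
rewrite [all _ _]/= => /andP[ha hs] /= /andP[hab hp]; rewrite big_cons.
have hb : b = - a.
  move: ha hs hab => /orP[]/eqP-> /andP[/orP[]/eqP-> _]; by [].
by case: (IH b hs hp) => ->; rewrite ?addr0 ?hb ?subrr; [right|left].
Qed.

Lemma asm_line_prefix (s : seq int) (k : nat) :
  all (mem [:: 0; 1; -1 : int]) s -> asm_line s -> 0 <= \sum_(a <- take k s) a.
Proof.
move=> hs /andP[halt /eqP hsum].
have nz (t : seq int) : \sum_(a <- t) a = \sum_(a <- [seq a <- t | a != 0]) a.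
  rewrite big_filter [RHS]big_mkcond /=; apply: eq_bigr => a _.
  by case: eqP => // ->.
have hpm : all (fun b => (b == 1) || (b == -1)) [seq a <- s | a != 0].
  rewrite all_filter; apply: sub_all hs => a.
  by rewrite /= !inE => /or3P[]/eqP->.
move: halt hpm hsum; rewrite /alternating nz.
rewrite -[in X in X -> _](cat_take_drop k s) -[in X in _ -> X -> _](cat_take_drop k s).
rewrite -[in X in _ -> _ -> X -> _](cat_take_drop k s) [X in _ <= X]nz !filter_cat.
case: [seq _ <- take k s | _] => [|a t]; first by rewrite big_nil.
rewrite cat_cons => hsort hall hsum.
have a1 : a = 1.
  by case: (alternating_sum hall hsort); rewrite hsum.
have hall' : all (fun b => (b == 1) || (b == -1)) (a :: t).
  by move: hall; rewrite -cat_cons all_cat => /andP[].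
have hsort' : sorted (fun b c => b * c < 0) (a :: t).
  by move: hsort; rewrite /= cat_path => /andP[].
by case: (alternating_sum hall' hsort') => ->; rewrite ?a1.
Qed.

Lemma asm_line_prefix_ord n (f : 'I_n -> int) (k : nat) :
  (forall i, f i \in [:: 0; 1; -1 : int]) -> asm_line [seq f i | i <- enum 'I_n] ->
  0 <= \sum_(i < n | (i < k)%N) f i.
Proof.
move=> hf hl.
have hall : all (mem [:: 0; 1; -1 : int]) [seq f i | i <- enum 'I_n].
  by apply/allP => _ /mapP[i _ ->]; exact: hf.
have := asm_line_prefix k hall hl.
rewrite -map_take big_map.
suff -> : take k (enum 'I_n) = [seq i : 'I_n <- enum 'I_n | (i < k)%N].
  by rewrite big_filter big_enum_cond.
apply: (inj_map (@ord_inj n)); rewrite map_take val_enum_ord.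
rewrite -(filter_map (@nat_of_ord n) (fun i => i < k)%N) val_enum_ord take_iota.
case: (leqP k n) => hk; first by rewrite -[LHS](filter_iota_ltn 0 hk).
by apply/esym/all_filterP/allP => i; rewrite mem_iota => /ltn_trans; apply.
Qed.

Lemma nu_ge0 n (A : 'M[asm_entry]_n) : A \in ASM n -> 0 <= nu (int_mx A).
Proof.
rewrite inE => /andP[/forallP hrow /forallP hcol].
have hA i j : int_mx A i j \in [:: 0; 1; -1 : int] by rewrite mxE; exact: ssvalP.
suff -> : nu (int_mx A) = \sum_(i' < n) \sum_(j < n)
    (\sum_(i < n | (i < i')%N) int_mx A i j) *
    (\sum_(j' < n | (j' < j.+1)%N) int_mx A i' j').
  apply: sumr_ge0 => i' _; apply: sumr_ge0 => j _.
  by apply: mulr_ge0; apply: asm_line_prefix_ord.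
rewrite /nu (exchange_big_dep xpredT) //=; apply: eq_bigr => i' _.
rewrite exchange_big /=; apply: eq_bigr => j _.
rewrite mulr_suml; apply: eq_bigr => i _.
by rewrite mulr_sumr.
Qed.

(* Z_n(x,y;z), as a polynomial in z; the absolute value only converts nu
   to a natural number (see [nu_ge0]). *)
Definition Zref (R : comNzRingType) n (x y : R) : {poly R} :=
  \sum_(A in ASM n)
    (x ^+ `|nu (int_mx A)|%N * y ^+ mu (int_mx A)) *: 'X^(rhoT (int_mx A)).

Definition Z (R : comNzRingType) n (x y : R) : R := (Zref n x y).[1].

Definition Zcoef (R : comNzRingType) n (x y : R) (k : nat) : R :=
  (Zref n x y)`_k.

Lemma Z0 (R : comNzRingType) (x y : R) : Z 0 x y = 1.
Proof.
have all0 (A B : 'M[asm_entry]_0) : A = B by apply/matrixP; case.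
pose A0 : 'M[asm_entry]_0 := \matrix_(i, j) SeqSub (mem_head 0 [:: 1; -1 : int]).
rewrite /Z /Zref (big_pred1 A0) => [|A].
  rewrite /nu big_ord0 /mu /rhoT !eq_card0 ?mulr1 ?scale1r ?hornerC //.
    by case.
  by case=> -[].
rewrite (all0 A A0) /= eqxx inE; apply/andP; split; by apply/forallP; case.
Qed.

Definition ratfun : fieldType := {fraction {mpoly int[2]}}.
Definition indet_x : ratfun := tofrac ('X_0 : {mpoly int[2]}).
Definition indet_y : ratfun := tofrac ('X_1 : {mpoly int[2]}).

(* Main.v *)
(* Row and column partial sums turn an ASM into a state of the six-vertex model with domain
   wall boundary; the weights can be chosen so that, writing x = r s and y = (1 - r)(1 - s),
   equal row parameters 1 - s and equal column parameters 1 - r give x^nu y^mu up to a common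
   factor, while a deviating parameter in the top row and in the left column records the
   position of the 1 there.  The Yang-Baxter equation makes the partition function symmetric
   in the row parameters, and interpolation in one column parameter then yields the
   Izergin-Korepin determinant.  The Desnanot-Jacobi identity becomes a bilinear relation
   between partition functions of sizes n, n - 1, n - 2; it is polynomial in all parameters
   and thus survives making all but one row and one column parameter equal.  With
   q = (1 - z)(1 - w) and X_n the part with A_11 <> 1 of the generating function recording the
   positions of the 1's in the top row (z) and in the left column (w), it reads
     q X_n(z,w) Z_(n-2)
       = z w (y (X_(n-1)(z,w) + Z_(n-2)) Z_(n-1) + (x q - y) Z_(n-1)(z) Z_(n-1)(w)).
   Dividing by (z w)^n and comparing the coefficients of (1 - z)^(i+1) (1 - w)^(i+1) expresses
   the i-th diagonal Taylor coefficient at size n through the (i+1)-st at size n - 1; this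
   telescopes to the formula, since X_n(1,1) = Z_n - Z_(n-1). *)
Require Import Defs.
From Stdlib Require Classical_Prop.
From HB Require Import structures.
From mathcomp Require Import all_boot all_order all_algebra all_field.
From mathcomp Require Import mpoly ring zify.
Set Implicit Arguments.
Unset Strict Implicit.
Unset Printing Implicit Defensive.
Import Order.TTheory GRing.Theory Num.Theory.
Local Open Scope ring_scope.

(** * The six-vertex model and its exchange relation *)

Lemma big_bool2 (V : nmodType) (F : bool * bool -> V) :
  \sum_p F p = \sum_(a : bool) \sum_(b : bool) F (a, b).
Proof. by rewrite pair_bigA /=; apply: eq_bigr => -[]. Qed.

Section SixVertex.
Variables (R : comNzRingType) (r s : R).
Implicit Types (u w v : R) (us vs : seq R) (t l k b : bool) (S T M : seq bool).

(* The edges are top [t], left [l], right [k], bottom [b]; an edge is [true] iff the partial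
   row or column sum of the matrix up to it is 1, so the entry at the vertex is [k - l = b - t].
   At [u = 1 - s], [v = 1 - r] the weights [0000] and [1111] multiply to [r s (r - s)^2], the
   weights of the entries [1] and [-1] to [(1 - r) (1 - s) (r - s)^2], and the two remaining
   weights are [r - s]. *)
Definition wt u v t l k b : R :=
  match t, l, k, b with
  | false, false, false, false => s * (u - v)
  | true, true, true, true => r * (u - v)
  | true, false, false, true | false, true, true, false => r * u - s * v
  | false, false, true, true => (r - s) * u
  | true, true, false, false => (r - s) * v
  | _, _, _, _ => 0
  end.

Definition bseqs n : seq (seq bool) :=
  iter n (fun L => [seq b :: T | b <- [:: false; true], T <- L]) [:: [::]].

(** [S] and [T] are the vertical edges above and below the row, [l] and [k] its outer horizontal
    edges; the inner ones are summed over. *)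
Fixpoint row_weight u vs l S T k : R :=
  match vs, S, T with
  | [::], [::], [::] => (l == k)%:R
  | v :: vs', t :: S', b :: T' =>
      \sum_(m : bool) wt u v t l m b * row_weight u vs' m S' T' k
  | _, _, _ => 0
  end.

Lemma row_weight_size u vs l S T k :
  (size S != size vs) || (size T != size vs) -> row_weight u vs l S T k = 0.
Proof.
elim: vs S T l => [|v vs IH] [|t S] [|b T] l //= h.
by rewrite big1 // => j _; rewrite IH ?mulr0.
Qed.

(* The top boundary is [S] and the bottom boundary is all [true]; rows enter from the left
   with [false] and leave with [true]. *)
Fixpoint pf vs us S : R :=
  if us is u :: us' then
    \sum_(T <- bseqs (size vs)) row_weight u vs false S T true * pf vs us' T
  else (all id S)%:R.

Definition dwpf us vs : R := pf vs us (nseq (size vs) false).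

Lemma big_bseqsS n (F : seq bool -> R) :
  \sum_(T <- bseqs n.+1) F T = \sum_(b : bool) \sum_(T <- bseqs n) F (b :: T).
Proof.
rewrite /bseqs iterS -/(bseqs n) big_allpairs_dep big_bool !big_cons big_nil /=.
by rewrite addrC addr0.
Qed.

(** The R-matrix: the weight of a crossing of two row lines with parameters [u] and [w]. *)
Definition rmat u w (l k : bool * bool) : R :=
  match l, k with
  | (false, false), (false, false) | (true, true), (true, true) => s * w - r * u
  | (false, true), (false, true) => (s - r) * w
  | (true, false), (true, false) => (s - r) * u
  | (false, true), (true, false) => r * (w - u)
  | (true, false), (false, true) => s * (w - u)
  | _, _ => 0
  end.

(** Moves a crossing through one column, exchanging the two rows. Fixing the six outer edges leaves
    64 polynomial identities, checked one by one. *)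
Lemma yang_baxter u w v (l q : bool * bool) t b :
  \sum_(p : bool * bool) rmat u w l p *
     (\sum_(m : bool) wt u v t p.1 q.1 m * wt w v m p.2 q.2 b) =
  \sum_(p : bool * bool)
     (\sum_(m : bool) wt w v t l.1 p.1 m * wt u v m l.2 p.2 b) * rmat u w p q.
Proof.
rewrite !big_bool2 !big_bool /=.
by case: l => [[] []]; case: q => [[] []]; case: t; case: b => /=; ring.
Qed.

Definition two_rows u w vs (l : bool * bool) S T (k : bool * bool) : R :=
  \sum_(M <- bseqs (size vs)) row_weight u vs l.1 S M k.1 * row_weight w vs l.2 M T k.2.

Lemma two_rows_cons u w v vs (l k : bool * bool) t b S T :
  two_rows u w (v :: vs) l (t :: S) (b :: T) k =
  \sum_(q : bool * bool) (\sum_(m : bool) wt u v t l.1 q.1 m * wt w v m l.2 q.2 b) *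
     two_rows u w vs q S T k.
Proof.
rewrite /two_rows /= big_bseqsS /=.
under eq_bigr do under eq_bigr do rewrite big_distrlr /=.
under [RHS]eq_bigr do rewrite mulr_suml.
rewrite [RHS]exchange_big; apply: eq_bigr => m _ /=.
rewrite exchange_big /= big_bool2.
apply: eq_bigr => q1 _; rewrite exchange_big; apply: eq_bigr => q2 _ /=.
by rewrite big_distrr; apply: eq_bigr => M _ /=; rewrite mulrACA.
Qed.

(** [yang_baxter], applied column by column, carries the crossing from the left end of the two rows
    to the right end. *)
Lemma two_rows_rmat u w vs (l k : bool * bool) S T :
  \sum_p rmat u w l p * two_rows u w vs p S T k =
  \sum_p two_rows w u vs l S T p * rmat u w p k.
Proof.
have [hS|hS] := boolP (size S == size vs); last first.
  by rewrite !big1 // => p _; rewrite /two_rows big1 ?mulr0 ?mul0r // => M _;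
    rewrite row_weight_size ?hS ?mul0r.
have [hT|hT] := boolP (size T == size vs); last first.
  by rewrite !big1 // => p _; rewrite /two_rows big1 ?mulr0 ?mul0r // => M _;
    rewrite [X in _ * X]row_weight_size ?hT ?orbT ?mulr0.
elim: vs l S T hS hT => [|v vs IH] l [|t S] [|b T] //= hS hT.
  rewrite /two_rows /= !big_bool2 !big_bool /= !big_seq1.
  by case: l => [[] []]; case: k => [[] []] => /=; ring.
under [LHS]eq_bigr do rewrite two_rows_cons mulr_sumr.
rewrite exchange_big /=.
transitivity (\sum_q (\sum_p rmat u w l p *
     (\sum_(m : bool) wt u v t p.1 q.1 m * wt w v m p.2 q.2 b)) * two_rows u w vs q S T k).
  by apply: eq_bigr => q _; rewrite mulr_suml; apply: eq_bigr => p _; rewrite mulrA.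
under [LHS]eq_bigr do rewrite yang_baxter mulr_suml.
rewrite exchange_big /=.
transitivity (\sum_p (\sum_(m : bool) wt w v t l.1 p.1 m * wt u v m l.2 p.2 b) *
   (\sum_q rmat u w p q * two_rows u w vs q S T k)).
  by apply: eq_bigr => p _; rewrite mulr_sumr; apply: eq_bigr => q _; rewrite mulrA.
under [LHS]eq_bigr do rewrite IH // mulr_sumr.
rewrite exchange_big /=; apply: eq_bigr => q _; rewrite two_rows_cons mulr_suml.
by apply: eq_bigr => p _; rewrite mulrA.
Qed.

End SixVertex.

Lemma mem_bseqs n (T : seq bool) : (T \in bseqs n) = (size T == n).
Proof.
elim: n T => [|n IH] T; first by rewrite /= inE size_eq0.
rewrite /bseqs iterS -/(bseqs n); apply/allpairsP/idP => [[[b T'] /= [_ h ->]]|].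
  by rewrite /= eqSS -IH.
case: T => [|b T] //=; rewrite eqSS -IH => h; exists (b, T); split => //=.
by case: b.
Qed.

Lemma uniq_bseqs n : uniq (bseqs n).
Proof.
elim: n => [|n IH] //; rewrite /bseqs iterS -/(bseqs n); apply: allpairs_uniq => //.
by move=> [? ?] [? ?] _ _ [-> ->].
Qed.

Lemma big_bseqs1 (V : nmodType) n (T0 : seq bool) (F : seq bool -> V) :
  size T0 = n -> \sum_(T <- bseqs n | T == T0) F T = F T0.
Proof.
move=> h; rewrite -big_filter filter_pred1_uniq ?uniq_bseqs ?big_seq1 //.
by rewrite mem_bseqs h.
Qed.

(** * Freezing, row exchange and degree in a column parameter *)

Section SixVertexFreezing.
Variables (R : comNzRingType) (r s : R).
Implicit Types (u w v : R) (us vs : seq R) (S T : seq bool).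
Local Notation wt := (wt r s).
Local Notation row_weight := (row_weight r s).
Local Notation pf := (pf r s).

(** With top [false] and left [true] the only nonzero weight passes both edges on, so the row is
    forced from left to right. *)
Lemma row_weight_frozen u vs T :
  row_weight u vs true (nseq (size vs) false) T true =
  if T == nseq (size vs) false then \prod_(v <- vs) (r * u - s * v) else 0.
Proof.
elim: vs T => [|v vs IH] [|b T] //=; first by rewrite big_nil.
rewrite big_bool /= big_cons IH !mul0r; case: b => /=; first by rewrite !mul0r addr0.
by rewrite addr0 eqseq_cons /=; case: ifP; rewrite ?mulr0.
Qed.

(** With top [true] and left [false] the only nonzero weight passes both edges on, so the first
    column is forced and every row enters the second column with [false]. *)
Lemma pf_frozen_column v vs us S :
  pf (v :: vs) us (true :: S) = (\prod_(u <- us) (r * u - s * v)) * pf vs us S.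
Proof.
elim: us S => [|u us IH] S /=; first by rewrite big_nil mul1r.
rewrite big_bseqsS big_bool /= [X in _ + X]big1 => [|T _]; last first.
  by rewrite big_bool /= !mul0r addr0 mul0r.
rewrite addr0 big_cons mulr_sumr; apply: eq_bigr => T _.
by rewrite big_bool /= IH mul0r add0r !mulrA; congr (_ * _); ring.
Qed.

(** Equal parameters make the weight [s * (u - v)] vanish, so the corner carries the entry 1; this
    freezes the rest of the top row and of the left column. *)
Lemma pf_frozen_corner u us vs :
  dwpf r s (u :: us) (u :: vs) =
  (r - s) * u * (\prod_(v <- vs) (r * u - s * v)) *
  (\prod_(w <- us) (r * w - s * u)) * dwpf r s us vs.
Proof.
rewrite /dwpf /= big_bseqsS big_bool /= [X in _ + X]big1 => [|T _]; last first.
  by rewrite big_bool /= subrr mulr0 !mul0r addr0 mul0r.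
rewrite addr0 -(@big_bseqs1 _ (size vs) (nseq (size vs) false)
  (fun T => (r - s) * u * (\prod_(v <- vs) (r * u - s * v)) *
     (\prod_(w <- us) (r * w - s * u)) * pf vs us T)); last by rewrite size_nseq.
rewrite [RHS]big_mkcond; apply: eq_bigr => T _; rewrite big_bool /= mul0r addr0.
rewrite row_weight_frozen; case: eqP => [->|_]; last by rewrite mulr0 mul0r.
by rewrite pf_frozen_column; ring.
Qed.

End SixVertexFreezing.

Section SixVertexMorphism.
Variables (R R' : comNzRingType) (f : {rmorphism R -> R'}) (r s : R).
Implicit Types (us vs : seq R) (S : seq bool).

Lemma pf_morph us vs S :
  f (pf r s vs us S) = pf (f r) (f s) (map f vs) (map f us) S.
Proof.
have fwt u v t l k b : f (wt r s u v t l k b) = wt (f r) (f s) (f u) (f v) t l k b.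
  by case: t; case: l; case: k; case: b => /=; rewrite ?(rmorph0, rmorphM, rmorphB).
have frw u vs' l S' T k :
  f (row_weight r s u vs' l S' T k) = row_weight (f r) (f s) (f u) (map f vs') l S' T k.
  elim: vs' l S' T => [|v vs' IH] l [|t S'] [|b T] /=; rewrite ?rmorph0 ?rmorph_nat //.
  by rewrite rmorph_sum; apply: eq_bigr => m _; rewrite rmorphM fwt IH.
elim: us S => [|u us IH] S /=; first by rewrite rmorph_nat.
by rewrite rmorph_sum size_map; apply: eq_bigr => T _; rewrite rmorphM frw IH.
Qed.

Lemma dwpf_morph us vs :
  f (dwpf r s us vs) = dwpf (f r) (f s) (map f us) (map f vs).
Proof. by rewrite /dwpf pf_morph size_map. Qed.

End SixVertexMorphism.

Section SixVertexExchange.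
Variables (R : idomainType) (r s : R).
Implicit Types (u w v : R) (us vs : seq R) (S T : seq bool).
Local Notation pf := (pf r s).

(** With both left edges [false] and both right edges [true], the R-matrix contributes the same
    scalar [s * w - r * u] on both sides of [two_rows_rmat], and it cancels. *)
Lemma pf_exchange u w us vs S : s * w - r * u != 0 ->
  pf vs (u :: w :: us) S = pf vs (w :: u :: us) S.
Proof.
move=> neq0.
have pf2 x y : pf vs (x :: y :: us) S =
    \sum_(T <- bseqs (size vs)) two_rows r s x y vs (false, false) S T (true, true) * pf vs us T.
  rewrite /=; under eq_bigr do rewrite mulr_sumr.
  rewrite exchange_big; apply: eq_bigr => T _; rewrite mulr_suml.
  by apply: eq_bigr => M _; rewrite mulrA.
rewrite !pf2; apply: eq_bigr => T _; congr (_ * _).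
have := two_rows_rmat r s u w vs (false, false) (true, true) S T.
rewrite !big_bool2 !big_bool /= !mul0r !mulr0 !addr0 !add0r mulrC.
by apply: mulIf.
Qed.

Lemma pf_exchange_front us1 u us2 vs S :
  (forall w, w \in us1 -> s * u - r * w != 0) ->
  pf vs (us1 ++ u :: us2) S = pf vs (u :: us1 ++ us2) S.
Proof.
elim: us1 S => [|w us1 IH] S neq0 //; rewrite cat_cons -pf_exchange; last first.
  by apply: neq0; rewrite mem_head.
rewrite [LHS]/=; apply: eq_bigr => T _; rewrite IH // => x hx.
by apply: neq0; rewrite inE hx orbT.
Qed.

End SixVertexExchange.

Section SixVertexDegree.
Variables (R : idomainType) (r s : R).

(** The first column has left edges [false]. Its weights have degree at most 1 in ['X], and the
    weight of the entry 1, where the column turns from [false] to [true], is constant. *)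
Lemma size_pf_column us vs t S :
  (size (pf r%:P s%:P ('X :: map polyC vs) (map polyC us) (t :: S)) <= size us + t)%N.
Proof.
have crw u l S' T k :
  row_weight r%:P s%:P u%:P (map polyC vs) l S' T k = (row_weight r s u vs l S' T k)%:P.
  have cwt v t' l' k' b : wt r%:P s%:P u%:P v%:P t' l' k' b = (wt r s u v t' l' k' b)%:P.
    by case: t'; case: l'; case: k'; case: b => /=; rewrite -?polyCB -?polyCM -?polyCB.
  elim: vs l S' T => [|v vs' IH] l [|t' S'] [|b T] /=; rewrite ?polyC0 // ?polyC_natr //.
  by rewrite [RHS]raddf_sum; apply: eq_bigr => m _; rewrite cwt IH -polyCM.
elim: us t S => [|u us IH] t S /=.
  by case: t => //=; rewrite ?size_poly0 // -polyC_natr (leq_trans (size_polyC_leq1 _)).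
have lin (a b c : R) : leq (size (a%:P * (b%:P * 'X + c%:P))) 2.
  rewrite mulrDr -!polyCM mulrA -polyCM.
  by apply: leq_trans (size_polyD _ _) _; rewrite geq_max; apply/andP; split;
    [apply: leq_trans (size_polyMleq _ _) _; rewrite size_polyX addn2 /= ltnS size_polyC_leq1
    |apply: leq_trans (size_polyC_leq1 _) _].
(* The bottom edge [b] is the top edge of the next vertex, so adding it to the size makes the bounds
   telescope down the column. *)
have w1 t' k b : (size (wt r%:P s%:P u%:P 'X t' false k b) + b <= 2 + t')%N.
  have e1 : s%:P * (u%:P - 'X) = s%:P * ((- 1)%:P * 'X + u%:P) by rewrite polyCN; ring.
  have e2 : r%:P * u%:P - s%:P * 'X = 1%:P * ((- s)%:P * 'X + (r * u)%:P) :> {poly R}.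
    by rewrite polyC1 polyCN polyCM; ring.
  case: t'; case: k; case: b; rewrite /= ?size_poly0 //.
  - by rewrite e2 addn1 ltnS lin.
  - by rewrite -polyCB -polyCM addn1 ltnS size_polyC_leq1.
  - by rewrite e1 addn0 lin.
apply: (leq_trans (size_sum _ _ _)); apply/bigmax_leqP_seq => -[|b T] _ _.
  by rewrite mul0r size_poly0.
rewrite big_distrl /=; apply: (leq_trans (size_sum _ _ _)).
apply/bigmax_leqP => k _; rewrite crw [_ * _%:P]mulrC -mulrA mul_polyC.
apply: leq_trans (size_scale_leq _ _) _; apply: leq_trans (size_polyMleq _ _) _.
have aux (i j c e m : nat) :
    (i + c <= 2 + e -> j <= m + c -> (i + j).-1 <= m.+1 + e)%N by lia.
exact: aux (w1 t k b) (IH b T).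
Qed.

Lemma size_dwpf_column us vs :
  (size (dwpf r%:P s%:P (map polyC us) ('X :: map polyC vs)) <= size us)%N.
Proof. by have := size_pf_column us vs false; rewrite addn0; apply. Qed.

End SixVertexDegree.

(** * The Izergin-Korepin determinant *)

Lemma prod_mkseq (R : comNzRingType) (T : Type) (f : nat -> T) n (F : T -> R) :
  \prod_(x <- mkseq f n) F x = \prod_(i < n) F (f i).
Proof. by rewrite /mkseq big_map -{1}[n]subn0 -/(index_iota 0 n) big_mkord. Qed.

Lemma mkseq_cat_bump (T : Type) (f : nat -> T) n k : (k <= n)%N ->
  exists us1 us2, [/\ mkseq f n.+1 = us1 ++ f k :: us2,
    mkseq (f \o bump k) n = us1 ++ us2 & us1 = mkseq f k].
Proof.
move=> le_kn; exists (mkseq f k), [seq f i | i <- iota k.+1 (n - k)]; split=> //.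
  by rewrite /mkseq -{1}(subnKC le_kn) -addnS iotaD map_cat.
rewrite /mkseq map_comp -map_cat; congr map.
rewrite -{1}(subnKC le_kn) iotaD map_cat add0n; congr (_ ++ _).
  rewrite -[RHS]map_id; apply/eq_in_map => i; rewrite mem_iota /= add0n => lt_ik.
  by rewrite /bump leqNgt lt_ik.
rewrite -addn1 addnC iotaDl; apply/eq_in_map => i; rewrite mem_iota /bump.
by move=> /andP[-> _].
Qed.

Section Vandermonde.
Variable R : comNzRingType.
Implicit Type u : nat -> R.

Definition vdm n u : R := \prod_(j < n) \prod_(i < j) (u j - u i).

(** The factors containing [u k] split off; the [k] of them that involve a smaller index give the
    sign. *)
Lemma vdm_bump n k u : (k <= n)%N ->
  vdm n.+1 u =
  (-1) ^+ k * (\prod_(i < n) (u (bump k i) - u k)) * vdm n (u \o bump k).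
Proof.
elim: n => [|n IH] in k *.
  by rewrite leqn0 => /eqP->; rewrite /vdm big_ord_recl !big_ord0 !mulr1.
rewrite leq_eqVlt => /orP[/eqP->|lt_kn].
  rewrite /vdm big_ord_recr /= mulrC; congr (_ * _).
    rewrite -[in (-1) ^+ _](card_ord n.+1) -prodrN; apply: eq_bigr => i _.
    by rewrite /bump leqNgt ltn_ord add0n opprB.
  apply: eq_bigr => j _; apply: eq_bigr => i _ /=.
  have lt_in : (i < n.+1)%N by apply: ltn_trans (ltn_ord i) (ltn_ord j).
  have bumpE m : (m < n.+1)%N -> bump n.+1 m = m by rewrite /bump ltnNge => /negbTE->.
  by rewrite !bumpE.
have bumpn : bump k n = n.+1 by rewrite /bump -ltnS lt_kn.
have vdmSr m w : vdm m.+1 w = vdm m w * \prod_(i < m) (w m - w i).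
  by rewrite /vdm big_ord_recr.
rewrite vdmSr (IH k) // (bigD1_ord (Ordinal lt_kn)) //= big_ord_recr /= vdmSr /= bumpn.
by ring.
Qed.

Lemma vdm_succ n u :
  vdm n.+1 u = (\prod_(i < n) (u i.+1 - u 0)) * vdm n (fun i => u i.+1).
Proof. by rewrite (@vdm_bump n 0) // mul1r. Qed.

End Vandermonde.

Section IzerginKorepin.
Variables (F : fieldType) (r s : F).
Implicit Types u v : nat -> F.

(** Up to constants, the product of the two kinds of weights of vertices with entry 0. *)
Definition ab (x y : F) : F := (x - y) * (r * x - s * y).

Definition fcons (c : F) v (j : nat) : F := if j is j'.+1 then v j' else c.

Definition ikmx n u v : 'M[F]_n := \matrix_(i, j) ((r - s) * u i / ab (u i) (v j)).

(** Distinctness makes the Vandermonde products nonzero, [ab] is the denominator in [ikmx], and the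
    last condition permits the exchange of any two rows. *)
Definition generic u v : Prop :=
  [/\ injective u, injective v, forall i j, ab (u i) (v j) != 0 &
      forall i j, i != j -> s * u i - r * u j != 0].

Lemma generic_comp u v f g : injective f -> injective g -> generic u v ->
  generic (u \o f) (v \o g).
Proof.
move=> finj ginj [hu hv hab hx]; split=> //.
- exact: inj_comp.
- exact: inj_comp.
- by move=> i j; apply: hab.
- by move=> i j ij; apply: hx; rewrite (inj_eq finj).
Qed.

Lemma bump_inj k : injective (bump k).
Proof. by move=> i j /(congr1 (unbump k)); rewrite !bumpK. Qed.

(** The determinant of [ikmx] with an indeterminate as first column parameter, expanded along that
    column and cleared of the denominators there. *)
Definition det_poly n u v : {poly F} :=
  \sum_(k < n.+1) ((r - s) * u k * ((-1) ^+ k * \det (ikmx n (u \o bump k) v)))%:P *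
    \prod_(i < n) (((u (bump k i))%:P - 'X) * ((r * u (bump k i))%:P - s%:P * 'X)).

Lemma size_det_poly n u v : (size (det_poly n u v) <= n.*2.+1)%N.
Proof.
apply: (leq_trans (size_sum _ _ _)); apply/bigmax_leqP => k _.
rewrite mul_polyC; apply: leq_trans (size_scale_leq _ _) _.
have sz (a b c d : F) : leq (size ((a%:P - b%:P * 'X) * (c%:P - d%:P * 'X))) 3.
  have lin (a' b' : F) : leq (size (a'%:P - b'%:P * 'X)) 2.
    apply: leq_trans (size_polyD _ _) _; rewrite size_polyN geq_max.
    rewrite (leq_trans (size_polyC_leq1 _)) //= mul_polyC.
    by apply: leq_trans (size_scale_leq _ _) _; rewrite size_polyX.
  by apply: leq_trans (size_polyMleq _ _) _; move: (lin a b) (lin c d); lia.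
have szp m (w : nat -> F) : leq (size (\prod_(i < m)
    (((w i)%:P - 'X) * ((r * w i)%:P - s%:P * 'X)))) m.*2.+1.
  elim: m => [|m IH]; first by rewrite big_ord0 size_poly1.
  rewrite big_ord_recr /=; apply: leq_trans (size_polyMleq _ _) _.
  have aux i j : leq i m.*2.+1 -> leq j 3 -> leq (i + j).-1 m.+1.*2.+1 by lia.
  by apply: aux => //; have := sz (w m) 1 (r * w m) s; rewrite mul1r.
exact: szp n (u \o bump k).
Qed.

Lemma det_polyE n u v c : (forall i, ab (u i) c != 0) ->
  (det_poly n u v).[c] = (\prod_(i < n.+1) ab (u i) c) *
     \det (ikmx n.+1 u (fcons c v)).
Proof.
move=> abn0; rewrite (expand_det_col _ ord0) mulr_sumr /det_poly horner_sum.
apply: eq_bigr => k _; rewrite hornerM hornerC horner_prod (bigD1_ord k) //= mxE /=.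
have -> : cofactor (ikmx n.+1 u (fcons c v)) k ord0 =
          (-1) ^+ k * \det (ikmx n (u \o bump k) v).
  rewrite /cofactor addn0; congr (_ * \det _).
  by apply/matrixP => i j; rewrite !mxE.
have -> : \prod_(i < n)
    (((u (bump k i))%:P - 'X) * ((r * u (bump k i))%:P - s%:P * 'X)).[c] =
    \prod_(i < n) ab (u (bump k i)) c.
  by apply: eq_bigr => i _; rewrite !hornerE.
by move: (abn0 k) => h; field.
Qed.

(** At [u k] every product that keeps the index [k] vanishes, so only the summand omitting row [k]
    survives. *)
Lemma det_poly_node n u v k : (k < n.+1)%N ->
  (det_poly n u v).[u k] = (r - s) * u k * ((-1) ^+ k * \det (ikmx n (u \o bump k) v)) *
    \prod_(i < n) ab (u (bump k i)) (u k).
Proof.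
move=> lt_kn; rewrite /det_poly horner_sum (bigD1 (Ordinal lt_kn)) //=.
rewrite [X in _ + X]big1 ?addr0 => [|j neq_jk].
  by rewrite hornerM hornerC horner_prod; congr (_ * _); apply: eq_bigr => i _; rewrite !hornerE.
have [i def_k _] := unlift_some neq_jk.
rewrite hornerM horner_prod (bigD1 i) //= [X in _ * (X * _)](_ : _ = 0) ?mul0r ?mulr0 //.
by have /(congr1 val) /= <- := def_k; rewrite !hornerE subrr mul0r.
Qed.

(* Both sides are polynomials of degree at most 2n in the first column parameter and agree
   at the n + 1 row parameters, where a corner of the lattice freezes, and at the n other
   column parameters, where both vanish. *)
Lemma izergin_korepin n u v : generic u v ->
  dwpf r s (mkseq u n) (mkseq v n) * (vdm n u * vdm n (fun i => - v i)) =
  (\prod_(i < n) \prod_(j < n) ab (u i) (v j)) * \det (ikmx n u v).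
Proof.
elim: n => [|n IH] in u v *.
  by move=> _; rewrite /vdm !big_ord0 det_mx00 !mulr1 /dwpf /=.
move=> gen; have [uinj vinj abn0 rn0] := gen.
pose v' j := v j.+1.
(* [P] and [Q] are the two sides as polynomials in the first column parameter. *)
pose P : {poly F} :=
  dwpf r%:P s%:P (map polyC (mkseq u n.+1)) ('X :: map polyC (mkseq v' n)) *
  ((vdm n.+1 u * vdm n (fun i => - v' i))%:P * \prod_(j < n) ('X - (v' j)%:P)).
pose Q : {poly F} := (\prod_(i < n.+1) \prod_(j < n) ab (u i) (v' j)) *: det_poly n u v'.
have PE c : P.[c] = dwpf r s (mkseq u n.+1) (c :: mkseq v' n) *
    (vdm n.+1 u * vdm n (fun i => - v' i) * \prod_(j < n) (c - v' j)).
  rewrite /P !hornerM hornerC horner_prod; congr (_ * (_ * _)).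
    have mapK (l : seq F) : map (horner_eval c) (map polyC l) = l.
      by elim: l => //= x l ->; rewrite /horner_eval hornerC.
    move: (mkseq u n.+1) (mkseq v' n) => us vs.
    have /= := dwpf_morph (horner_eval c : {rmorphism _ -> _}) r%:P s%:P
      (map polyC us) ('X :: map polyC vs).
    by rewrite !mapK /horner_eval !hornerC hornerX.
  by apply: eq_bigr => j _; rewrite !hornerE.
have QE c : (forall i, ab (u i) c != 0) ->
    Q.[c] = (\prod_(i < n.+1) \prod_(j < n.+1)
              ab (u i) (fcons c v' j)) *
     \det (ikmx n.+1 u (fcons c v')).
  move=> cn0; rewrite hornerZ det_polyE // mulrA; congr (_ * _).
  by rewrite -big_split /=; apply: eq_bigr => i _; rewrite [RHS]big_ord_recl mulrC.
suff PQ : P = Q.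
  have := congr1 (fun p => p.[v 0%N]) PQ; rewrite PE QE //.
  have -> : v 0%N :: mkseq v' n = mkseq v n.+1.
    by rewrite /mkseq /= -[1%N]/(1 + 0)%N iotaDl -map_comp.
  have vE : v =1 fcons (v 0%N) v' by case.
  rewrite [vdm n.+1 (fun i => - v i)]vdm_succ => e.
  transitivity (dwpf r s (mkseq u n.+1) (mkseq v n.+1) *
    (vdm n.+1 u * vdm n (fun i => - v' i) * \prod_(j < n) (v 0%N - v' j))).
    congr (_ * _); rewrite -mulrA [X in _ = _ * X]mulrC; congr (_ * (_ * _)).
    by apply: eq_bigr => j _; rewrite opprK addrC.
  rewrite e; congr (_ * _).
    by apply: eq_bigr => i _; apply: eq_bigr => j _; rewrite -vE.
  by congr (\det _); apply/matrixP => i j; rewrite !mxE -vE.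
apply/eqP; rewrite -subr_eq0; apply/eqP.
(* The listed points are distinct and their number [2n + 1] bounds the sizes of [P] and [Q]. *)
apply: (@roots_geq_poly_eq0 _ _ (mkseq u n.+1 ++ mkseq v' n)).
- rewrite all_cat; apply/andP; split; apply/allP => x /mapP[k]; rewrite mem_iota add0n /=.
    move=> lt_kn ->; rewrite rootE hornerD hornerN PE hornerZ det_poly_node // subr_eq0.
    have [us1 [us2 [-> e2 e1]]] := mkseq_cat_bump u (lt_kn : (k <= n)%N).
    (* Row exchange brings row [k] to the top, where its parameter equals that of the first
       column. *)
    rewrite /dwpf pf_exchange_front; last first.
      rewrite e1 => w /mapP[i]; rewrite mem_iota add0n /= => lt_ik ->.
      by apply: rn0; rewrite eq_sym; apply/negP => /eqP e; rewrite e ltnn in lt_ik.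
    rewrite -/(dwpf r s (u k :: us1 ++ us2) (u k :: _)) pf_frozen_corner -e2.
    rewrite !prod_mkseq (@vdm_bump _ n k) //.
    have := IH (u \o bump k) v' (generic_comp (@bump_inj k) (@succn_inj : injective succn) gen).
    rewrite (bigD1_ord (Ordinal lt_kn)) //= => IHk.
    have -> : \prod_(j < n) ab (u k) (v' j) =
        (\prod_(j < n) (r * u k - s * v' j)) * \prod_(j < n) (u k - v' j).
      by rewrite -big_split; apply: eq_bigr => j _; rewrite /= /ab mulrC.
    have -> : \prod_(i < n) ab (u (bump k i)) (u k) =
        (\prod_(j < n) (r * u (bump k j) - s * u k)) * \prod_(j < n) (u (bump k j) - u k).
      by rewrite -big_split; apply: eq_bigr => j _; rewrite /= /ab mulrC.
    move: IHk; set D := dwpf _ _ _ _; set V1 := vdm n _; set V2 := vdm n _.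
    set p0 := \prod_(i < n) \prod_(j < n) _; set dt := \det _ => IHk.
    set p1 := \prod_(i < n) _; set p2 := \prod_(i < n) _; set p3 := \prod_(i < n) _.
    set p4 := \prod_(i < n) _.
    apply/eqP; transitivity ((r - s) * u k * (-1) ^+ k * p1 * p2 * p3 * p4 * (D * (V1 * V2))).
      by ring.
    by rewrite IHk; ring.
  (* At [v' k] a linear factor of [P] is zero and the matrix in [Q] has two equal columns. *)
  move=> lt_kn ->; rewrite rootE hornerD hornerN PE (bigD1 (Ordinal lt_kn)) //= subrr.
  rewrite mul0r !mulr0 add0r oppr_eq0 QE => [|i]; last exact: abn0.
  rewrite [\det _](_ : _ = 0) ?mulr0 //.
  have lt_kn1 : (k.+1 < n.+1)%N by [].
  rewrite -det_tr (@determinant_alternate _ _ _ ord0 (Ordinal lt_kn1)) // => j.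
  by rewrite !mxE.
- rewrite cat_uniq !mkseq_uniq ?andbT //; last by apply: (inj_comp vinj); apply: succn_inj.
  apply/hasP => -[_ /mapP[j _ ->] /mapP[i _ e]].
  by have := abn0 i j.+1; rewrite -/(v' j) e /ab subrr mul0r eqxx.
rewrite size_cat !size_mkseq addSn addnn.
apply: leq_trans (size_polyD _ _) _; rewrite size_polyN geq_max; apply/andP; split.
  rewrite /P mul_polyC; apply: leq_trans (size_polyMleq _ _) _.
  have szS := size_dwpf_column r s (mkseq u n.+1) (mkseq v' n).
  have := size_scale_leq (vdm n.+1 u * vdm n (fun i => - v' i)) (\prod_(j < n) ('X - (v' j)%:P)).
  rewrite size_prod_XsubC /index_enum -enumT size_enum_ord => szV.
  have aux i j : leq i n.+1 -> leq j n.+1 -> leq (i + j).-1 n.*2.+1 by lia.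
  by apply: aux szV; rewrite size_mkseq in szS.
by apply: leq_trans (size_scale_leq _ _) _; apply: size_det_poly.
Qed.

End IzerginKorepin.

(** * Bilinear relations *)

Section DesnanotJacobi.

(** Entries are indexed by naturals, so that deleting a row or column is a reindexing by [succn] or
    [bump 1]. *)
Definition detf (R : comNzRingType) n (f : nat -> nat -> R) : R :=
  \det (\matrix_(i < n, j < n) f i j).

Lemma detf_morph (R R' : comNzRingType) (phi : {rmorphism R -> R'}) n f :
  phi (detf n f) = detf n (fun i j => phi (f i j)).
Proof. by rewrite /detf -det_map_mx; congr (\det _); apply/matrixP => i j; rewrite !mxE. Qed.

Lemma det2 (R : comNzRingType) (A : 'M[R]_2) :
  \det A = A ord0 ord0 * A ord_max ord_max - A ord0 ord_max * A ord_max ord0.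
Proof.
rewrite (expand_det_row _ ord0) !big_ord_recl big_ord0 addr0 /cofactor !det_mx11 !mxE /=.
rewrite expr0 expr1 mul1r mulN1r mulrN.
by congr (_ * A _ _ - A _ _ * A _ _); apply: val_inj.
Qed.

Lemma det_schur (F : fieldType) k m (A : 'M[F]_k) B C (D : 'M_m) : D \in unitmx ->
  \det (block_mx A B C D) = \det (A - B *m invmx D *m C) * \det D.
Proof.
move=> unitD; rewrite -[LHS]mulr1 -(det1 F (k + m)).
have <- : \det (block_mx 1%:M 0 (- (invmx D *m C)) 1%:M : 'M[F]_(k + m)) =
    \det (1%:M : 'M[F]_(k + m)).
  by rewrite det_lblock !det1 mulr1.
rewrite -det_mulmx mulmx_block !mulmx1 !mulmx0 !add0r !mulmxN !mulmxA.
by rewrite mulmxV // mul1mx subrr det_ublock.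
Qed.

(** Each larger determinant is [\det D] times a minor of the 2 x 2 Schur complement [g] of [D],
    which reduces the identity to the formula for a 2 x 2 determinant. *)
Lemma detf_desnanot_jacobi_unit (F : fieldType) m (f : nat -> nat -> F) :
  detf m (fun i j => f i.+2 j.+2) != 0 ->
  detf m.+2 f * detf m (fun i j => f i.+2 j.+2) =
  detf m.+1 (fun i j => f (bump 1 i) (bump 1 j)) * detf m.+1 (fun i j => f i.+1 j.+1) -
  detf m.+1 (fun i j => f (bump 1 i) j.+1) * detf m.+1 (fun i j => f i.+1 (bump 1 j)).
Proof.
set D := \matrix_(i < m, j < m) f i.+2 j.+2; rewrite -[detf m _]/(\det D) => Dn0.
have unitD : D \in unitmx by rewrite unitmxE unitfE.
pose b i : 'rV[F]_m := \row_j f i j.+2; pose c j : 'cV[F]_m := \col_i f i.+2 j.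
pose g i j := f i j - (b i *m invmx D *m c j) 0 0.
have det1E (h k : nat -> nat) : (forall i, h i.+1 = i.+2) -> (forall i, k i.+1 = i.+2) ->
    detf m.+1 (fun i j => f (h i) (k j)) = g (h 0%N) (k 0%N) * \det D.
  move=> hS kS; rewrite /detf.
  have -> : (\matrix_(i < m.+1, j < m.+1) f (h i) (k j)) =
    block_mx (f (h 0%N) (k 0%N))%:M (b (h 0%N)) (c (k 0%N)) D :> 'M_(1 + m).
    apply/matrixP => i j; rewrite -[i]splitK -[j]splitK.
    case: (split i) => i'; case: (split j) => j' /=;
      rewrite ?(block_mxEul, block_mxEur, block_mxEdl, block_mxEdr) !mxE ?ord1 /=.
    - by rewrite mulr1n.
    - by rewrite add1n kS.
    - by rewrite add1n hS.
    - by rewrite !add1n hS kS.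
  by rewrite (@det_schur F 1 m) // det_mx11 /g !mxE mulr1n.
have -> : detf m.+2 f = (g 0%N 0%N * g 1%N 1%N - g 0%N 1%N * g 1%N 0%N) * \det D.
  rewrite /detf.
  have -> : (\matrix_(i < m.+2, j < m.+2) f i j) =
    block_mx (\matrix_(i < 2, j < 2) f i j) (\matrix_(i < 2, j < m) f i j.+2)
      (\matrix_(i < m, j < 2) f i.+2 j) D :> 'M_(2 + m).
    apply/matrixP => i j; rewrite -[i]splitK -[j]splitK.
    by case: (split i) => i'; case: (split j) => j' /=;
      rewrite ?(block_mxEul, block_mxEur, block_mxEdl, block_mxEdr) !mxE.
  rewrite (@det_schur F 2 m) // det2.
  have e (i j : 'I_2) : (\matrix_(i < 2, j < 2) f i j - \matrix_(i < 2, j < m) f i j.+2 *m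
      invmx D *m \matrix_(i < m, j < 2) f i.+2 j) i j = g i j.
    rewrite /g !mxE; congr (_ - _); apply: eq_bigr => k _.
    rewrite !mxE; congr (_ * _); by apply: eq_bigr => l _; rewrite ?mxE.
  by rewrite !e.
rewrite (det1E (bump 1) (bump 1)) // (det1E succn succn) // (det1E (bump 1) succn) //.
by rewrite (det1E succn (bump 1)) //= /bump /=; ring.
Qed.

(* Adding an indeterminate to the diagonal makes the central minor invertible. *)
Lemma detf_desnanot_jacobi (F : fieldType) m (f : nat -> nat -> F) :
  detf m.+2 f * detf m (fun i j => f i.+2 j.+2) =
  detf m.+1 (fun i j => f (bump 1 i) (bump 1 j)) * detf m.+1 (fun i j => f i.+1 j.+1) -
  detf m.+1 (fun i j => f (bump 1 i) j.+1) * detf m.+1 (fun i j => f i.+1 (bump 1 j)).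
Proof.
pose fX i j : {poly F} := (f i j)%:P + (if i == j then 'X else 0).
pose to0 : {rmorphism {poly F} -> F} := horner_eval 0.
have fX0 n h k : to0 (detf n (fun i j => fX (h i) (k j))) = detf n (fun i j => f (h i) (k j)).
  rewrite detf_morph /detf; congr (\det _); apply/matrixP => i j; rewrite !mxE /fX.
  by rewrite /to0 /= /horner_eval hornerD hornerC; case: eqP; rewrite ?hornerX ?hornerC addr0.
have := fX0 m.+2 id id; have := fX0 m (fun i => i.+2) (fun i => i.+2).
have := fX0 m.+1 (bump 1) (bump 1); have := fX0 m.+1 succn succn.
have := fX0 m.+1 (bump 1) succn; have := fX0 m.+1 succn (bump 1).
move=> <- <- <- <- <- <-; rewrite -!rmorphM -rmorphB; congr (to0 _).
have phiI : injective (@tofrac {poly F}) by move=> p q /eqP; rewrite tofrac_eq => /eqP.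
apply: phiI; rewrite rmorphB !rmorphM /= !(detf_morph (@tofrac {poly F})).
apply: (detf_desnanot_jacobi_unit (f := fun i j => tofrac (fX i j))).
rewrite -(detf_morph (@tofrac {poly F}) m (fun i j => fX i.+2 j.+2)) tofrac_eq0.
have -> : detf m (fun i j => fX i.+2 j.+2) = char_poly (\matrix_(i < m, j < m) - f i.+2 j.+2).
  rewrite /detf /char_poly; congr (\det _); apply/matrixP => i j; rewrite !mxE.
  rewrite /fX !eqSS polyCN opprK addrC; congr (_ + _).
  by rewrite val_eqE; case: eqP; rewrite ?mulr1n ?mulr0n.
by rewrite monic_neq0 ?char_poly_monic.
Qed.

End DesnanotJacobi.

Section PartitionFunctionDesnanotJacobi.

(** [izergin_korepin] turns each partition function into a determinant. Under Desnanot-Jacobi the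
    Vandermonde and [ab] products cancel except for factors at the indices 0 and 1. *)
Lemma dwpf_bilinear_generic (F : fieldType) (r s : F) m (u v : nat -> F) : generic r s u v ->
  let Z n f g := dwpf r s (mkseq (u \o f) n) (mkseq (v \o g) n) in
  (u 1%N - u 0%N) * (v 0%N - v 1%N) * Z m.+2 id id * Z m (fun i => i.+2) (fun i => i.+2) =
  ab r s (u 0%N) (v 1%N) * ab r s (u 1%N) (v 0%N) *
    (Z m.+1 (bump 1) (bump 1) * Z m.+1 succn succn) -
  ab r s (u 0%N) (v 0%N) * ab r s (u 1%N) (v 1%N) *
    (Z m.+1 (bump 1) succn * Z m.+1 succn (bump 1)).
Proof.
move=> gen Z; have [uinj vinj abn0 _] := gen.
have IK n f g : injective f -> injective g ->
    Z n f g * (vdm n (u \o f) * vdm n (fun i => - v (g i))) =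
    (\prod_(i < n) \prod_(j < n) ab r s (u (f i)) (v (g j))) *
    detf n (fun i j => (r - s) * u (f i) / ab r s (u (f i)) (v (g j))).
  move=> finj ginj; rewrite (izergin_korepin n (generic_comp finj ginj gen)).
  by [].
have vdmn0 n (w : nat -> F) : injective w -> vdm n w != 0.
  move=> winj; apply/prodf_neq0 => j _; apply/prodf_neq0 => i _.
  by rewrite subr_eq0 (inj_eq winj) neq_ltn ltn_ord orbT.
have SSinj : injective (fun i => i.+2) by move=> i j [].
have b1 := @bump_inj 1; have b0 : injective succn by exact: succn_inj.
have oppI f : injective f -> injective (fun i => - v (f i)).
  by move=> finj i j /oppr_inj /vinj /finj.
pose Vu := vdm m.+1 (u \o bump 1) * vdm m.+1 (u \o succn).
pose Vv := vdm m.+1 (fun i => - v (bump 1 i)) * vdm m.+1 (fun i => - v i.+1).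
have Vn0 : Vu * Vv != 0.
  by rewrite /Vu /Vv !mulf_neq0 // vdmn0 //;
    [apply: inj_comp|apply: inj_comp|apply: oppI|apply: oppI].
have vdm2 (w : nat -> F) : vdm m.+2 w * vdm m (fun i => w i.+2) =
    (w 1%N - w 0%N) * (vdm m.+1 (w \o bump 1) * vdm m.+1 (w \o succn)).
  by rewrite vdm_succ big_ord_recl /= [vdm m.+1 (w \o bump 1)]vdm_succ /=; ring.
apply: (mulIf Vn0).
pose G i j := ab r s (u i) (v j); pose p := \prod_(i < m) \prod_(j < m) G i.+2 j.+2.
have prod1 f g : (forall i, f i.+1 = i.+2) -> (forall i, g i.+1 = i.+2) ->
    \prod_(i < m.+1) \prod_(j < m.+1) G (f i) (g j) =
    G (f 0%N) (g 0%N) * (\prod_(j < m) G (f 0%N) j.+2) * (\prod_(i < m) G i.+2 (g 0%N)) * p.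
  move=> fS gS.
  have row k : \prod_(j < m.+1) G k (g j) = G k (g 0%N) * \prod_(j < m) G k j.+2.
    by rewrite big_ord_recl; congr (_ * _); apply: eq_bigr => j _; rewrite -gS.
  have rows : (\prod_(i < m) G i.+2 (g 0%N)) * p =
      \prod_(i < m) \prod_(j < m.+1) G (f i.+1) (g j).
    by rewrite -big_split; apply: eq_bigr => i _; rewrite row -fS.
  by rewrite -mulrA rows -row big_ord_recl.
have prod2 : \prod_(i < m.+2) \prod_(j < m.+2) G i j =
    G 0%N 0%N * G 0%N 1%N * G 1%N 0%N * G 1%N 1%N *
    (\prod_(j < m) G 0%N j.+2) * (\prod_(j < m) G 1%N j.+2) *
    (\prod_(i < m) G i.+2 0%N) * (\prod_(i < m) G i.+2 1%N) * p.
  have row k : \prod_(j < m.+2) G k j = G k 0%N * G k 1%N * \prod_(j < m) G k j.+2.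
    by rewrite !big_ord_recl mulrA.
  have rows : \prod_(i < m) \prod_(j < m.+2) G i.+2 j =
      (\prod_(i < m) G i.+2 0%N) * (\prod_(i < m) G i.+2 1%N) * p.
    by rewrite -!big_split; apply: eq_bigr => i _; rewrite row.
  have recl (H : nat -> F) : \prod_(i < m.+2) H i = H 0%N * H 1%N * \prod_(i < m) H i.+2.
    by rewrite !big_ord_recl mulrA.
  rewrite (recl (fun i => \prod_(j < m.+2) G i j)) rows !row.
  by move: p {prod1 rows} => p'; ring.
have idinj : injective (id : nat -> nat) by [].
have eD := detf_desnanot_jacobi m (fun i j => (r - s) * u i / ab r s (u i) (v j)).
have e22 := IK m.+2 id id idinj idinj; have e0 := IK m _ _ SSinj SSinj.
have e11 := IK m.+1 _ _ b1 b1; have e00 := IK m.+1 _ _ b0 b0.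
have e10 := IK m.+1 _ _ b1 b0; have e01 := IK m.+1 _ _ b0 b1.
have eu := vdm2 u; have ev := vdm2 (fun i => - v i).
rewrite (prod1 (bump 1) (bump 1)) // in e11; rewrite (prod1 succn succn) // in e00.
rewrite (prod1 (bump 1) succn) // in e10; rewrite (prod1 succn (bump 1)) // in e01.
rewrite prod2 in e22; rewrite -/p in e0.
(* Pure algebra: [z] are partition functions, [d] determinants, [x] and [y] Vandermonde products,
   [g] the values of [ab] at indices 0 and 1, and [ra], [rb], [ca], [cb], [q] the remaining products
   of [ab]. *)
have key (z2 z0 z11 z00 z10 z01 d2 d0 d11 d00 d10 d01 x2 x0 x1 x1' y2 y0 y1 y1'
    g00 g01 g10 g11 ra rb ca cb q du dv : F) :
  z2 * (x2 * y2) = g00 * g01 * g10 * g11 * ra * rb * ca * cb * q * d2 ->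
  z0 * (x0 * y0) = q * d0 ->
  z11 * (x1 * y1) = g00 * ra * ca * q * d11 -> z00 * (x1' * y1') = g11 * rb * cb * q * d00 ->
  z10 * (x1 * y1') = g01 * ra * cb * q * d10 -> z01 * (x1' * y1) = g10 * rb * ca * q * d01 ->
  x2 * x0 = du * (x1 * x1') -> y2 * y0 = dv * (y1 * y1') ->
  d2 * d0 = d11 * d00 - d10 * d01 ->
  du * dv * z2 * z0 * (x1 * x1' * (y1 * y1')) =
  (g01 * g10 * (z11 * z00) - g00 * g11 * (z10 * z01)) * (x1 * x1' * (y1 * y1')).
  move=> h2 h0 h11 h00 h10 h01 hx hy hd.
  transitivity ((z2 * (x2 * y2)) * (z0 * (x0 * y0))).
    transitivity (z2 * z0 * (x2 * x0) * (y2 * y0)); last by ring.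
    by rewrite hx hy; ring.
  transitivity (g01 * g10 * ((z11 * (x1 * y1)) * (z00 * (x1' * y1'))) -
    g00 * g11 * ((z10 * (x1 * y1')) * (z01 * (x1' * y1)))); last by ring.
  rewrite h2 h0 h11 h00 h10 h01.
  transitivity (g00 * g01 * g10 * g11 * ra * rb * ca * cb * q * q * (d2 * d0)); first by ring.
  by rewrite hd; ring.
have dvE : v 0%N - v 1%N = - v 1%N - - v 0%N by rewrite opprK addrC.
rewrite {}dvE; exact: key e22 e0 e11 e00 e10 e01 eu ev eD.
Qed.

(* The relation is polynomial, so it suffices to perturb the parameters by distinct powers of
   an indeterminate, which makes them generic, and to specialise it to 0. *)
Lemma dwpf_bilinear (R : idomainType) (r s u1 u2 v1 v2 : R) (us vs : seq R) :
  r != 0 -> size us = size vs ->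
  let w x y := (x - y) * (r * x - s * y) in
  (u2 - u1) * (v1 - v2) * dwpf r s (u1 :: u2 :: us) (v1 :: v2 :: vs) * dwpf r s us vs =
  w u1 v2 * w u2 v1 * (dwpf r s (u1 :: us) (v1 :: vs) * dwpf r s (u2 :: us) (v2 :: vs)) -
  w u1 v1 * w u2 v2 * (dwpf r s (u1 :: us) (v2 :: vs) * dwpf r s (u2 :: us) (v1 :: vs)).
Proof.
move=> rn0 eq_sz w.
pose phi : {rmorphism {poly R} -> {fraction {poly R}}} := @tofrac {poly R}.
have phi_eq0 p : (phi p == 0) = (p == 0) by apply: tofrac_eq0.
have phiI : injective phi by move=> p q /eqP; rewrite tofrac_eq => /eqP.
(* Odd exponents for the rows and even ones for the columns keep all perturbations distinct. *)
pose u i : {poly R} := (nth 0 [:: u1, u2 & us] i)%:P + 'X^(i.*2.+1).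
pose v i : {poly R} := (nth 0 [:: v1, v2 & vs] i)%:P + 'X^(i.*2.+2).
pose to0 : {rmorphism {poly R} -> R} := horner_eval 0.
have linn0 (a b c : R) i j : i != j -> a != 0 -> c%:P + a%:P * 'X^(i.+1) + b%:P * 'X^(j.+1) != 0.
  move=> neq an0; apply/negP => /eqP /(congr1 (fun p : {poly R} => p`_i.+1)).
  rewrite !coefD coefC !coefCM !coefXn eqxx coef0 /= eqSS (negbTE neq) mulr1 mulr0 add0r addr0.
  by move/eqP; rewrite (negbTE an0).
have gen : generic (phi r%:P) (phi s%:P) (phi \o u) (phi \o v).
  split.
  - apply: inj_comp phiI _ => i j /eqP; rewrite -subr_eq0; apply: contraTeq => neq.
    have := @linn0 1 (-1) (nth 0 [:: u1, u2 & us] i - nth 0 [:: u1, u2 & us] j) i.*2 j.*2.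
    rewrite polyCB polyC1 polyCN polyC1 => h; have := h _ (oner_neq0 _); rewrite /u.
    rewrite (inj_eq double_inj) => /(_ neq); congr (_ != _); by ring.
  - apply: inj_comp phiI _ => i j /eqP; rewrite -subr_eq0; apply: contraTeq => neq.
    have := @linn0 1 (-1) (nth 0 [:: v1, v2 & vs] i - nth 0 [:: v1, v2 & vs] j) i.*2.+1 j.*2.+1.
    rewrite polyCB polyC1 polyCN polyC1 => h; have := h _ (oner_neq0 _); rewrite /v.
    rewrite eqSS (inj_eq double_inj) => /(_ neq); congr (_ != _); by ring.
  - move=> i j; rewrite /ab /= -!rmorphM -!rmorphB -rmorphM phi_eq0 mulf_neq0 //.
      have := @linn0 1 (-1) (nth 0 [:: u1, u2 & us] i - nth 0 [:: v1, v2 & vs] j) i.*2 j.*2.+1.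
      rewrite polyCB polyC1 polyCN polyC1 => h; have := h _ (oner_neq0 _); rewrite /u /v.
      have -> : i.*2 != j.*2.+1 by apply/negP => /eqP/(congr1 odd); rewrite /= !odd_double.
      by move=> /(_ isT); congr (_ != _); ring.
    have := @linn0 r (-s) (r * nth 0 [:: u1, u2 & us] i - s * nth 0 [:: v1, v2 & vs] j) i.*2 j.*2.+1.
    rewrite polyCB !polyCM polyCN => h; have := h _ rn0; rewrite /u /v.
    have -> : i.*2 != j.*2.+1 by apply/negP => /eqP/(congr1 odd); rewrite /= !odd_double.
    by move=> /(_ isT); congr (_ != _); ring.
  move=> i j neq; rewrite /= -!rmorphM -!rmorphB phi_eq0.
  have := @linn0 (- r) s (s * nth 0 [:: u1, u2 & us] i - r * nth 0 [:: u1, u2 & us] j) j.*2 i.*2.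
  rewrite oppr_eq0 (inj_eq double_inj) eq_sym => /(_ neq rn0).
  rewrite polyCB !polyCM polyCN /u; congr (_ != _); by ring.
have := dwpf_bilinear_generic (size us) gen.
have phiE n f g : dwpf (phi r%:P) (phi s%:P) (mkseq ((phi \o u) \o f) n)
    (mkseq ((phi \o v) \o g) n) =
    phi (dwpf r%:P s%:P (mkseq (u \o f) n) (mkseq (v \o g) n)).
  by rewrite dwpf_morph /mkseq -!map_comp.
have uE i : to0 (u i) = nth 0 [:: u1, u2 & us] i.
  by rewrite /u rmorphD rmorphXn /= /horner_eval hornerC hornerX expr0n addr0.
have vE i : to0 (v i) = nth 0 [:: v1, v2 & vs] i.
  by rewrite /v rmorphD rmorphXn /= /horner_eval hornerC hornerX expr0n addr0.
have cE c : to0 c%:P = c by rewrite /to0 /= /horner_eval hornerC.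
have to0E n f g k l :
    mkseq (fun i => nth 0 [:: u1, u2 & us] (f i)) n = k ->
    mkseq (fun i => nth 0 [:: v1, v2 & vs] (g i)) n = l ->
    to0 (dwpf r%:P s%:P (mkseq (u \o f) n) (mkseq (v \o g) n)) = dwpf r s k l.
  move=> <- <-; rewrite dwpf_morph !cE /mkseq -!map_comp.
  by congr dwpf; apply: eq_map => i /=; rewrite ?uE ?vE.
have nthB (x1 x2 : R) xs : mkseq (fun i => nth 0 [:: x1, x2 & xs] (bump 1 i)) (size xs).+1 = x1 :: xs.
  by rewrite -[RHS](mkseq_nth 0); apply: eq_mkseq => -[].
have nthS (x1 x2 : R) xs : mkseq (fun i => nth 0 [:: x1, x2 & xs] i.+1) (size xs).+1 = x2 :: xs.
  by rewrite -[RHS](mkseq_nth 0); apply: eq_mkseq => -[].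
have nthSS (x1 x2 : R) xs : mkseq (fun i => nth 0 [:: x1, x2 & xs] i.+2) (size xs) = xs.
  by rewrite -[RHS](mkseq_nth 0); apply: eq_mkseq => -[].
have nth0 (x1 x2 : R) xs : mkseq (fun i => nth 0 [:: x1, x2 & xs] i) (size xs).+2 = [:: x1, x2 & xs].
  by rewrite -[RHS](mkseq_nth 0).
rewrite /= !phiE /ab /= -!(rmorphM, rmorphB) => /phiI /(congr1 to0).
rewrite !(rmorphM, rmorphB) !uE !vE !cE.
rewrite (to0E _ _ _ [:: u1, u2 & us] [:: v1, v2 & vs]) ?nth0 ?eq_sz ?nth0 //.
rewrite -eq_sz.
rewrite (to0E _ _ _ us vs) ?nthSS ?eq_sz ?nthSS // -?eq_sz.
rewrite (to0E _ _ _ (u1 :: us) (v1 :: vs)) ?nthB ?eq_sz ?nthB // -?eq_sz.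
rewrite (to0E _ _ _ (u2 :: us) (v2 :: vs)) ?nthS ?eq_sz ?nthS // -?eq_sz.
rewrite (to0E _ _ _ (u1 :: us) (v2 :: vs)) ?nthB ?eq_sz ?nthS // -?eq_sz.
by rewrite (to0E _ _ _ (u2 :: us) (v1 :: vs)) ?nthS ?eq_sz ?nthB // -?eq_sz.
Qed.

End PartitionFunctionDesnanotJacobi.

(** * Alternating sign matrices as six-vertex states *)

Section LineCharacterization.
Implicit Types (s : seq int) (p : int).

Definition is01 p : bool := (p == 0) || (p == 1).

(** With partial sum [p] so far, the last nonzero entry counts as [2p - 1]; the opposite sign is
    exactly what keeps the next partial sum in {0, 1}. *)
Lemma alternating_scanl s p : all (mem [:: 0; 1; -1 : int]) s -> is01 p ->
  path (fun a b => a * b < 0) (p *+ 2 - 1) [seq a <- s | a != 0] = all is01 (scanl +%R p s).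
Proof.
elim: s p => [|a s IH] p //= /andP[ha hs] hp.
move: ha; rewrite !inE => /or3P[]/eqP-> /=; first by rewrite addr0 hp IH.
  case/orP: hp => /eqP-> /=; last by [].
  by rewrite -IH.
case/orP: hp => /eqP-> /=; first by [].
by rewrite -IH.
Qed.

Lemma asm_lineE s : all (mem [:: 0; 1; -1 : int]) s ->
  asm_line s = all is01 (scanl +%R 0 s) && (\sum_(a <- s) a == 1).
Proof.
move=> hs; rewrite -alternating_scanl // /asm_line /alternating mul0rn add0r.
have nz (t : seq int) : \sum_(a <- t) a = \sum_(a <- [seq a <- t | a != 0]) a.
  rewrite big_filter [RHS]big_mkcond /=; apply: eq_bigr => a _.
  by case: eqP => // ->.
have hpm : all (fun b => (b == 1) || (b == -1)) [seq a <- s | a != 0].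
  rewrite all_filter; apply: sub_all hs => a.
  by rewrite /= !inE => /or3P[]/eqP->.
rewrite nz; case: [seq a <- s | a != 0] hpm => [|a t] // hall.
case: eqP => [hsum|]; rewrite ?andbF // !andbT.
apply/idP/idP => [hsort|/path_sorted //].
(* An alternating sequence sums to 0 or to its first entry, so the sum 1 makes the first entry 1. *)
have a1 : a = 1 by case: (alternating_sum hall hsort); rewrite hsum.
by rewrite a1 /= in hsort *.
Qed.

Lemma asm_line_mkseq (g : nat -> int) n : (forall i, g i \in [:: 0; 1; -1 : int]) ->
  asm_line (mkseq g n) =
  [forall k : 'I_n, is01 (\sum_(j < k.+1) g j)] && (\sum_(j < n) g j == 1).
Proof.
move=> hg; rewrite asm_lineE; last by apply/allP => _ /mapP[i _ ->]; apply: hg.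
have sumE k : \sum_(a <- mkseq g k) a = \sum_(j < k) g j.
  by rewrite /mkseq big_map -{1}[k]subn0 -/(index_iota 0 k) big_mkord.
have foldE k : foldl +%R 0 (mkseq g k) = \sum_(j < k) g j.
  by elim: k => [|k IH]; rewrite ?big_ord0 // mkseqS foldl_rcons IH big_ord_recr.
rewrite sumE; congr (_ && _); apply/(all_nthP 0)/forallP => h k.
  have := h k; rewrite size_scanl size_mkseq ltn_ord => /(_ isT).
  rewrite nth_scanl ?size_mkseq // /mkseq -map_take take_iota.
  by rewrite (minn_idPl (ltn_ord k)) -/(mkseq g k.+1) foldE.
rewrite size_scanl size_mkseq => lt_kn.
rewrite nth_scanl ?size_mkseq // /mkseq -map_take take_iota.
by rewrite (minn_idPl lt_kn) -/(mkseq g k.+1) foldE; apply: (h (Ordinal lt_kn)).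
Qed.

End LineCharacterization.

(** Entries at natural indices, extended by 0, so that partial sums and shifted rows need no
    ordinals. *)
Definition mxf m n (A : 'M[asm_entry]_(m, n)) (i j : nat) : int :=
  if insub i is Some i' then if insub j is Some j' then ssval (A i' j') else 0 else 0.

Lemma mxf_ord m n (A : 'M[asm_entry]_(m, n)) (i : 'I_m) (j : 'I_n) : mxf A i j = ssval (A i j).
Proof. by rewrite /mxf !valK. Qed.

Lemma mxf_in m n (A : 'M[asm_entry]_(m, n)) i j : mxf A i j \in [:: 0; 1; -1 : int].
Proof. by rewrite /mxf; case: insub => [i'|] //; case: insub => [j'|] //; apply: ssvalP. Qed.

Lemma mxf_tr n (A : 'M[asm_entry]_n) i j : mxf A^T i j = mxf A j i.
Proof. by rewrite /mxf; case: insub => [i'|]; case: insub => [j'|] //; rewrite mxE. Qed.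

Definition asm_lines n (f : nat -> nat -> int) : bool :=
  [forall i : 'I_n, [forall k : 'I_n, is01 (\sum_(j < k.+1) f i j)] && (\sum_(j < n) f i j == 1)].

Lemma mem_ASM n (A : 'M[asm_entry]_n) :
  (A \in ASM n) = asm_lines n (mxf A) && asm_lines n (fun i j => mxf A j i).
Proof.
have enumE (g : nat -> int) : [seq g (j : nat) | j : 'I_n <- enum 'I_n] = mkseq g n.
  by rewrite /mkseq -val_enum_ord -map_comp.
rewrite inE /is_asm; congr (_ && _); apply: eq_forallb => i.
  rewrite -(@asm_line_mkseq (mxf A i)) => [|j]; last exact: mxf_in.
  by rewrite -enumE; congr asm_line; apply: eq_map => j; rewrite mxE mxf_ord.
rewrite -(@asm_line_mkseq (fun k => mxf A k i)) => [|j]; last exact: mxf_in.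
by rewrite -enumE; congr asm_line; apply: eq_map => j; rewrite mxE mxf_ord.
Qed.

Lemma trmx_ASM n (A : 'M[asm_entry]_n) : (A^T \in ASM n) = (A \in ASM n).
Proof.
rewrite !mem_ASM andbC; congr (_ && _); rewrite /asm_lines; apply: eq_forallb => i.
  by congr (_ && _); [apply: eq_forallb => k; congr is01|congr (_ == _)];
    apply: eq_bigr => j _; rewrite mxf_tr.
by congr (_ && _); [apply: eq_forallb => k; congr is01|congr (_ == _)];
    apply: eq_bigr => j _; rewrite mxf_tr.
Qed.

Definition entry (z : int) : asm_entry := insubd (SeqSub (mem_head 0 [:: 1; -1 : int])) z.

Lemma entryK z : z \in [:: 0; 1; -1 : int] -> ssval (entry z) = z.
Proof. by move=> hz; apply: (insubdK (SeqSub (mem_head 0 [:: 1; -1 : int])) hz). Qed.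

Definition bz (b : bool) : int := b%:Z.

Lemma bz01 b : is01 (bz b). Proof. by case: b. Qed.
Lemma bzK p : is01 p -> bz (p == 1) = p. Proof. by case/orP=> /eqP->. Qed.

Definition diff_row n (S T : seq bool) : 'rV[asm_entry]_n :=
  \row_j entry (bz (nth false T j) - bz (nth false S j)).

Lemma mxf_diff_row n S T j : (j < n)%N ->
  mxf (diff_row n S T) 0 j = bz (nth false T j) - bz (nth false S j).
Proof.
move=> lt_jn; rewrite -[j]/(nat_of_ord (Ordinal lt_jn)).
rewrite -[X in mxf _ X](@erefl _ (nat_of_ord (ord0 : 'I_1))).
rewrite mxf_ord mxE entryK //.
by case: (nth _ T _); case: (nth _ S _).
Qed.

(** A row of entries keeping the column sums in {0, 1} corresponds to the vertical edges [T] below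
    it; by hypothesis the other rows contribute 0. *)
Lemma sum_rows (V : nmodType) n (S : seq bool) (G : 'rV[asm_entry]_n -> V) :
  (forall a j, (j < n)%N -> ~~ is01 (bz (nth false S j) + mxf a 0 j) -> G a = 0) ->
  \sum_a G a = \sum_(T <- bseqs n) G (diff_row n S T).
Proof.
move=> G0; rewrite -(big_map (diff_row n S) xpredT G) [RHS]big_uniq; last first.
  rewrite map_inj_in_uniq ?uniq_bseqs // => T T'; rewrite !mem_bseqs => /eqP sT /eqP sT' eqT.
  apply: (@eq_from_nth _ false) => [|j]; rewrite ?sT ?sT' // => lt_jn.
  have := congr1 (fun a => mxf a 0 j) eqT; rewrite !mxf_diff_row // => /addIr.
  by case: (nth _ T _); case: (nth _ T' _).
rewrite [RHS]big_mkcond; apply: eq_bigr => a _.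
case: ifP => // /negbT notin; apply/eqP; apply: contraNT notin => Gn0.
have ok j : (j < n)%N -> is01 (bz (nth false S j) + mxf a 0 j).
  by move=> lt_jn; apply: contraNT Gn0 => /G0 ->.
apply/mapP; exists (mkseq (fun j => bz (nth false S j) + mxf a 0 j == 1) n).
  by rewrite mem_bseqs size_mkseq.
apply/rowP => j; rewrite mxE nth_mkseq // bzK ?ok // addrC addKr.
apply: val_inj; rewrite /= entryK ?mxf_in //.
by rewrite -[0%N]/(nat_of_ord (ord0 : 'I_1)) mxf_ord.
Qed.

Section StateSum.
Variables (R : comNzRingType) (r s : R).
Implicit Types (u v : R) (us vs : seq R) (S T : seq bool) (f : nat -> nat -> int).
Local Notation wt := (wt r s).

(** The vertex weight in terms of the partial sums [t] above and [l] to the left and of the entry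
    [a]. *)
Definition wtz u v (t l a : int) : R :=
  if [&& is01 t, is01 l, is01 (t + a) & is01 (l + a)]
  then wt u v (t == 1) (l == 1) (l + a == 1) (t + a == 1) else 0.

(** The vertical edges fix the entries and thereby all horizontal edges, so at most one term of the
    sum over inner edges is nonzero. *)
Lemma row_weight_wtz u vs l S T : size S = size vs -> size T = size vs ->
  let a j := bz (nth false T j) - bz (nth false S j) in
  row_weight r s u vs l S T true =
  (\prod_(j < size vs) wtz u (nth 0 vs j) (bz (nth false S j)) (bz l + \sum_(k < j) a k) (a j)) *
    (bz l + \sum_(j < size vs) a j == 1)%:R.
Proof.
elim: vs l S T => [|v vs IH] l [|t S] [|b T] //= => [_ _|[sS] [sT]].
  by rewrite !big_ord0 mul1r addr0; case: l.
have -> : \sum_(m : bool) wt u v t l m b * row_weight r s u vs m S T true =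
   wtz u v (bz t) (bz l) (bz b - bz t) *
     row_weight r s u vs (bz l + (bz b - bz t) == 1) S T true.
  rewrite big_bool /wtz bz01; case: t; case: l; case: b;
  rewrite /bz /= ?(mul0r, add0r, addr0) //.
rewrite big_ord_recl /= !big_ord0 addr0 -!mulrA.
have [ok|nok] := boolP (is01 (bz l + (bz b - bz t))); last first.
  by rewrite /wtz (negbTE nok) !andbF !mul0r.
congr (_ * _); rewrite IH // bzK //; congr (_ * _).
  by apply: eq_bigr => j _; rewrite /= big_ord_recl /= -!addrA.
by rewrite big_ord_recl /= -!addrA.
Qed.

(** [c] holds the column sums contributed by rows already removed at the top. *)
Definition state_weight us vs (c : nat -> int) f : R :=
  (\prod_(i < size us) \prod_(j < size vs)
     wtz (nth 0 us i) (nth 0 vs j) (c j + \sum_(k < i) f k j) (\sum_(k < j) f i k) (f i j)) *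
  (\prod_(i < size us) (\sum_(j < size vs) f i j == 1)%:R) *
  (\prod_(j < size vs) (c j + \sum_(i < size us) f i j == 1)%:R).

Lemma eq_state_weight us vs c c' f f' :
  (forall j, (j < size vs)%N -> c j = c' j) ->
  (forall i j, (i < size us)%N -> (j < size vs)%N -> f i j = f' i j) ->
  state_weight us vs c f = state_weight us vs c' f'.
Proof.
move=> eqc eqf; congr (_ * _ * _).
- apply: eq_bigr => i _; apply: eq_bigr => j _; rewrite eqc // eqf //.
  congr (wtz _ _ (_ + _) _ _); apply: eq_bigr => k _; apply: eqf => //.
    exact: ltn_trans (ltn_ord k) (ltn_ord i).
  exact: ltn_trans (ltn_ord k) (ltn_ord j).
- apply: eq_bigr => i _; congr ((_ == _)%:R); apply: eq_bigr => j _; exact: eqf.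
- apply: eq_bigr => j _; rewrite eqc //; congr ((_ + _ == _)%:R).
  by apply: eq_bigr => i _; apply: eqf.
Qed.

Lemma state_weight_cons u us vs c f :
  state_weight (u :: us) vs c f =
  (\prod_(j < size vs) wtz u (nth 0 vs j) (c j) (\sum_(k < j) f 0%N k) (f 0%N j)) *
    (\sum_(j < size vs) f 0%N j == 1)%:R *
  state_weight us vs (fun j => c j + f 0%N j) (fun i j => f i.+1 j).
Proof.
rewrite /state_weight /= !big_ord_recl /=.
have -> : \prod_(j < size vs) wtz u (nth 0 vs j) (c j + \sum_(k < 0) f k j)
            (\sum_(k < j) f 0%N k) (f 0%N j) =
          \prod_(j < size vs) wtz u (nth 0 vs j) (c j) (\sum_(k < j) f 0%N k) (f 0%N j).
  by apply: eq_bigr => j _; rewrite big_ord0 addr0.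
have -> : \prod_(i < size us) \prod_(j < size vs)
     wtz (nth 0 us i) (nth 0 vs j) (c j + \sum_(k < bump 0 i) f k j)
         (\sum_(k < j) f (bump 0 i) k) (f (bump 0 i) j) =
  \prod_(i < size us) \prod_(j < size vs)
     wtz (nth 0 us i) (nth 0 vs j) (c j + f 0%N j + \sum_(k < i) f k.+1 j)
         (\sum_(k < j) f i.+1 k) (f i.+1 j).
  by apply: eq_bigr => i _; apply: eq_bigr => j _; rewrite big_ord_recl addrA.
have -> : \prod_(j < size vs) ((c j + \sum_(i < (size us).+1) f i j == 1)%:R : R) =
  \prod_(j < size vs) (c j + f 0%N j + \sum_(i < size us) f i.+1 j == 1)%:R.
  by apply: eq_bigr => j _; rewrite big_ord_recl addrA.
by rewrite /bump /=; set x1 := \prod_(_ < _) _; ring.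
Qed.

Lemma mxf_col_mx0 m n (a : 'rV[asm_entry]_n) (A : 'M_(m, n)) j :
  mxf (col_mx a A) 0 j = mxf a 0 j.
Proof.
rewrite /mxf (valK (lshift m (ord0 : 'I_1)) : insub 0%N = _) (valK (ord0 : 'I_1) : insub 0%N = _).
by case: insub => // j'; rewrite col_mxEu.
Qed.

Lemma mxf_col_mxS m n (a : 'rV[asm_entry]_n) (A : 'M_(m, n)) i j :
  mxf (col_mx a A) i.+1 j = mxf A i j.
Proof.
rewrite /mxf; have [lt_im|le_mi] := ltnP i m; last first.
  by rewrite !insubN // -leqNgt.
rewrite (valK (rshift 1 (Ordinal lt_im)) : insub i.+1 = _) (valK (Ordinal lt_im) : insub i = _).
by case: insub => // j'; rewrite col_mxEd.
Qed.

Lemma pf_state_sum us vs S : size S = size vs ->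
  pf r s vs us S = \sum_(A : 'M[asm_entry]_(size us, size vs))
                      state_weight us vs (fun j => bz (nth false S j)) (mxf A).
Proof.
elim: us S => [|u us IH] S sS.
  have all0 (A B : 'M[asm_entry]_(0, size vs)) : A = B by apply/matrixP; case.
  pose A0 : 'M[asm_entry]_(0, size vs) := \matrix_(i, j) entry 0.
  rewrite (big_pred1 A0) => [|A]; last by rewrite (all0 A A0) /= eqxx.
  rewrite /state_weight !big_ord0 !mul1r /=.
  under eq_bigr do rewrite big_ord0 addr0.
  rewrite -sS; elim: S {sS} => [|t S IH] /=; first by rewrite big_ord0.
  by rewrite big_ord_recl -IH; case: t; rewrite ?mul1r ?mul0r.
rewrite [RHS](reindex (fun p : 'rV_(size vs) * 'M_(size us, size vs) => col_mx p.1 p.2)) /=; last first.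
  exists (fun A : 'M_(1 + size us, size vs) => (usubmx A, dsubmx A)) => [[a A]|A] _ /=.
    by rewrite col_mxKu col_mxKd.
  by rewrite vsubmxK.
rewrite -(pair_bigA _ (fun a A => state_weight (u :: us) vs (fun j => bz (nth false S j))
   (mxf (col_mx a A)))) /=.
rewrite (@sum_rows _ _ S) => [|a j lt_jn nok]; last first.
  rewrite big1 // => A _; rewrite state_weight_cons (bigD1 (Ordinal lt_jn)) //=.
  by rewrite mxf_col_mx0 /wtz (negbTE nok) !andbF !mul0r.
apply: eq_big_seq => T; rewrite mem_bseqs => /eqP sT.
rewrite row_weight_wtz // IH // mulr_sumr; apply: eq_bigr => A _.
rewrite state_weight_cons; congr (_ * _).
  congr (_ * _).
    apply: eq_bigr => j _; rewrite add0r mxf_col_mx0 mxf_diff_row //; congr (wtz _ _ _ _ _).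
    apply: eq_bigr => k _; rewrite mxf_col_mx0 mxf_diff_row //.
    exact: ltn_trans (ltn_ord k) (ltn_ord j).
  rewrite add0r; congr ((_ == _)%:R); apply: eq_bigr => j _.
  by rewrite mxf_col_mx0 mxf_diff_row.
apply: eq_state_weight => [j lt_j|i j _ _]; last by rewrite mxf_col_mxS.
by rewrite mxf_col_mx0 mxf_diff_row // addrC subrK.
Qed.

End StateSum.

Section StateSumASM.
Variables (R : comNzRingType) (r s : R).
Implicit Types (us vs : seq R).

Definition vertex_weights us vs n (f : nat -> nat -> int) : R :=
  \prod_(i < n) \prod_(j < n)
    wtz r s (nth 0 us i) (nth 0 vs j) (\sum_(k < i) f k j) (\sum_(k < j) f i k) (f i j).

(** A partial sum outside {0, 1} makes a vertex weight vanish and a wrong line sum makes an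
    indicator vanish, so only alternating sign matrices contribute. *)
Lemma dwpf_ASM n us vs : size us = n -> size vs = n ->
  dwpf r s us vs = \sum_(A in ASM n) vertex_weights us vs n (mxf A).
Proof.
move=> su sv; rewrite /dwpf pf_state_sum ?size_nseq //.
have swE f : state_weight r s us vs (fun j => bz (nth false (nseq (size vs) false) j)) f =
    vertex_weights us vs n f * (\prod_(i < n) (\sum_(j < n) f i j == 1)%:R) *
      (\prod_(j < n) (\sum_(i < n) f i j == 1)%:R).
  rewrite (@eq_state_weight _ _ _ _ _ _ (fun=> 0) _ f) // => [|j _]; last first.
    by rewrite nth_nseq if_same.
  rewrite /state_weight su sv /vertex_weights; congr (_ * _ * _).
    by apply: eq_bigr => i _; apply: eq_bigr => j _; rewrite add0r.
  by apply: eq_bigr => j _; rewrite add0r.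
under eq_bigr do rewrite swE.
rewrite su sv [RHS]big_mkcond; apply: eq_bigr => A _; rewrite mem_ASM.
case: ifP => [/andP[/forallP hr /forallP hc]|/negbT].
  rewrite big1 => [|i _]; last by have /andP[_ ->] := hr i.
  rewrite mulr1 big1 ?mulr1 // => j _; by have /andP[_ ->] := hc j.
rewrite negb_and => /orP[] /forallPn[i]; rewrite negb_and => /orP[/forallPn[k bad]|bad].
- rewrite /vertex_weights (bigD1 i) //= (bigD1 k) //= /wtz.
  by rewrite big_ord_recr /= in bad; rewrite (negbTE bad) !andbF !mul0r.
- by rewrite (bigD1 i) //= (negbTE bad) mul0r mulr0 mul0r.
- rewrite /vertex_weights (bigD1 k) //= (bigD1 i) //= /wtz.
  by rewrite big_ord_recr /= in bad; rewrite (negbTE bad) !andbF !mul0r.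
by rewrite [X in _ * X](bigD1 i) //= (negbTE bad) mul0r mulr0.
Qed.

End StateSumASM.

(** * Weights of alternating sign matrices *)

Section AlternatingSignStatistics.
Variables (n : nat) (A : 'M[asm_entry]_n).
Hypothesis ASM_A : A \in ASM n.
Let f := mxf A.
Local Notation top i j := (\sum_(k < i) f k j).
Local Notation left i j := (\sum_(k < j) f i k).

Lemma int_mxE i j : int_mx A i j = f i j.
Proof. by rewrite mxE -mxf_ord. Qed.

Lemma left01 i j : (i < n)%N -> (j <= n)%N -> is01 (left i j).
Proof.
move=> lt_in le_jn; move: ASM_A; rewrite mem_ASM => /andP[/forallP /(_ (Ordinal lt_in))].
move=> /andP[/forallP h _] _; case: j le_jn => [|j] lt_jn; first by rewrite big_ord0.
exact: (h (Ordinal lt_jn)).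
Qed.

Lemma top01 i j : (i <= n)%N -> (j < n)%N -> is01 (top i j).
Proof.
move=> le_in lt_jn; move: ASM_A; rewrite mem_ASM => /andP[_ /forallP /(_ (Ordinal lt_jn))].
move=> /andP[/forallP h _]; case: i le_in => [|i] lt_in; first by rewrite big_ord0.
exact: (h (Ordinal lt_in)).
Qed.

Lemma left_full i : (i < n)%N -> left i n = 1.
Proof.
move=> lt_in; move: ASM_A; rewrite mem_ASM => /andP[/forallP /(_ (Ordinal lt_in))].
by move=> /andP[_ /eqP].
Qed.

Lemma top_full j : (j < n)%N -> top n j = 1.
Proof.
move=> lt_jn; move: ASM_A; rewrite mem_ASM => /andP[_ /forallP /(_ (Ordinal lt_jn))].
by move=> /andP[_ /eqP].
Qed.

(** Grouped by [i'] and [j], [nu] is a sum of products of a column sum above a vertex and a row sum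
    through it. Both are 0 or 1, so [nu] counts the vertices [1111]. *)
Lemma nu_vertices :
  nu (int_mx A) = (\sum_(i < n) \sum_(j < n) ((top i j == 1) && (left i j.+1 == 1)))%N :> int.
Proof.
have widen (g : nat -> int) k : (k <= n)%N -> \sum_(i < n | (i < k)%N) g i = \sum_(i < k) g i.
  by move=> le_kn; rewrite (big_ord_widen n g le_kn).
transitivity (\sum_(i < n) \sum_(j < n) top i j * left i j.+1).
  rewrite /nu (exchange_big_dep xpredT) //=; apply: eq_bigr => i' _.
  rewrite exchange_big /=; apply: eq_bigr => j _.
  rewrite -(widen (fun k => f k j)) ?(ltnW (ltn_ord i')) // -(widen (f i') j.+1) ?ltn_ord //.
  rewrite mulr_suml; apply: eq_bigr => i _; rewrite mulr_sumr.
  by apply: eq_bigr => j' _; rewrite !int_mxE.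
rewrite -natz natr_sum; apply: eq_bigr => i _; rewrite natr_sum; apply: eq_bigr => j _.
have := left01 (ltn_ord i) (ltn_ord j); have := top01 (ltnW (ltn_ord i)) (ltn_ord j).
by case/orP=> /eqP-> /orP[]/eqP->.
Qed.

Lemma mu_vertices : mu (int_mx A) = (\sum_(i < n) \sum_(j < n) (f i j == -1)%R)%N.
Proof.
rewrite /mu -sum1dep_card big_mkcond -(pair_bigA _ (fun i j => if int_mx A i j == -1 then 1%N else 0%N)) /=.
by apply: eq_bigr => i _; apply: eq_bigr => j _; rewrite int_mxE; case: eqP.
Qed.

(** The summand is 1 at vertices [0000], -1 at [1111] and 0 elsewhere, so the two kinds are equally
    many. The totals of [top] and [left] come from full rows and columns summing to 1. *)
Lemma vertex_balance : \sum_(i < n) \sum_(j < n) (1 - top i j - left i j.+1) = 0.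
Proof.
have sum1 m (g : nat -> int) : (forall k, (k < m)%N -> g k = 1) -> \sum_(k < m) g k = m%:Z.
  move=> h; rewrite (eq_bigr (fun=> 1)) => [|k _]; last by rewrite h.
  by rewrite sumr_const card_ord natz.
have tops : \sum_(i < n) \sum_(j < n) top i j = \sum_(i < n) i%:Z.
  apply: eq_bigr => i _; rewrite exchange_big (sum1 i (fun k => left k n)) // => k lt_ki.
  by rewrite left_full // (ltn_trans lt_ki).
have lefts : \sum_(i < n) \sum_(j < n) left i j.+1 = \sum_(j < n) j.+1%:Z.
  rewrite exchange_big; apply: eq_bigr => j _.
  rewrite exchange_big (sum1 j.+1 (fun k => top n k)) // => k lt_kj.
  by rewrite top_full // (leq_trans lt_kj).
have arith m : \sum_(i < m) i%:Z + \sum_(i < m) i.+1%:Z = (m * m)%:Z.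
  by elim: m => [|m IH]; rewrite ?big_ord0 // !big_ord_recr /= addrACA IH; lia.
have consts : \sum_(i < n) \sum_(j < n) (1 : int) = (n * n)%:Z.
  by rewrite !sumr_const !card_ord -mulrnA natz.
under eq_bigr do rewrite !sumrB.
by rewrite !sumrB consts tops lefts -arith; ring.
Qed.

End AlternatingSignStatistics.

(** Column sums of length 1 are the entries of the top row; hence these are 0 or 1, and their sum 1
    leaves a single 1. *)
Lemma top_row n (A : 'M[asm_entry]_n.+1) : A \in ASM n.+1 ->
  (rhoT (int_mx A) <= n)%N /\
  forall j, (j <= n)%N -> mxf A 0 j = (j == rhoT (int_mx A))%:Z.
Proof.
move=> ASM_A.
have f01 j : (j <= n)%N -> is01 (mxf A 0 j).
  by move=> le_jn; have := top01 ASM_A (isT : (1 <= n.+1)%N) (le_jn : (j < n.+1)%N); rewrite big_ord1.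
have fsum := left_full ASM_A (ltn0Sn n).
have [p fp] : exists p : 'I_n.+1, mxf A 0 p = 1.
  have [/existsP[p /eqP fp]|/existsPn none] := boolP [exists p : 'I_n.+1, mxf A 0 p == 1].
    by exists p.
  move: fsum; rewrite big1 // => j _; have := f01 j (ltn_ord j).
  by rewrite /is01 (negbTE (none j)) orbF => /eqP.
have fE j : (j <= n)%N -> mxf A 0 j = (j == p)%:Z.
  move=> le_jn; case: eqP => [->//|/eqP neq_jp].
  pose j' : 'I_n.+1 := Ordinal (le_jn : (j < n.+1)%N).
  have neq' : j' != p by rewrite -val_eqE.
  move: fsum; rewrite (bigD1 p) //= fp => /(canRL (addKr _)); rewrite addNr => rest0.
  apply: (psumr_eq0P (F := fun i : 'I_n.+1 => mxf A 0 i) _ rest0 neq') => i _.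
  by have := f01 i (ltn_ord i); case/orP=> /eqP->.
suff -> : rhoT (int_mx A) = p by split=> //; rewrite -ltnS ltn_ord.
have A0 (t j : 'I_n.+1) : t == 0%N :> nat -> int_mx A t j = (j == p)%:Z.
  by move=> /eqP t0; rewrite int_mxE t0 fE // -ltnS ltn_ord.
rewrite /rhoT; transitivity #|[set j : 'I_n.+1 | (j < p)%N]|.
  apply: eq_card => j; rewrite !inE; apply/existsP/idP => [[t /existsP[k]]|lt_jp].
    by case/and4P=> t0 lt_jk; rewrite !(A0 t) //; case: (k =P p) => [<-|] //.
  exists ord0; apply/existsP; exists p; rewrite !A0 // !eqxx lt_jp /=.
  by rewrite -val_eqE (ltn_eqF lt_jp).
rewrite -sum1_card; under eq_bigl do rewrite inE.
by rewrite -(big_ord_widen n.+1 (fun=> 1%N)) ?sum1_card ?card_ord // ltnW.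
Qed.

Lemma left_top_row n (A : 'M[asm_entry]_n.+1) j : A \in ASM n.+1 -> (j <= n.+1)%N ->
  \sum_(k < j) mxf A 0 k = (rhoT (int_mx A) < j)%N%:Z.
Proof.
move=> ASM_A; have [_ fE] := top_row ASM_A.
elim: j => [|j IH] lt_jn; first by rewrite big_ord0.
rewrite big_ord_recr /= IH ?(ltnW lt_jn) // fE // (ltnS (rhoT _)).
by case: (ltngtP j (rhoT _)).
Qed.

Lemma prod_position (R : comNzRingType) (a b c : R) n q : (q < n)%N ->
  \prod_(j < n) (if (j < q)%N then a else if j == q :> nat then c else b) =
  a ^+ q * c * b ^+ (n - q.+1).
Proof.
move=> lt_qn; rewrite -(big_mkord xpredT (fun j => if (j < q)%N then a else if j == q then c else b)).
rewrite (@big_cat_nat _ _ _ q) ?(ltnW lt_qn) //= [X in _ * X]big_ltn // ltnn eqxx mulrA.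
congr (_ * _ * _).
  rewrite (eq_big_nat _ _ (F2 := fun=> a)) ?prodr_const_nat ?subn0 // => j /andP[_ lt_jq].
  by rewrite lt_jq.
rewrite (eq_big_nat _ _ (F2 := fun=> b)) ?prodr_const_nat // => j /andP[lt_qj _].
by rewrite ltnNge (ltnW lt_qj) gtn_eqF.
Qed.

Section WeightOfASM.
Variables (F : fieldType) (r s : F).
Hypotheses (s_neq0 : s != 0) (s_neq1 : 1 - s != 0) (rs_neq : r - s != 0).

(* The asymmetry between the weights [0000] and [1111] is carried by the power of [s], whose
   exponents sum to 0 over an ASM (see [vertex_balance]). *)
Definition bulk (t l a : int) : F :=
  (r - s) * (r * s) ^+ ((t == 1) && (l + a == 1)) * s ^ (1 - t - (l + a)) *
  ((1 - r) * (1 - s)) ^+ (a == -1) * (1 - s) ^ a.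

(** The correction to [bulk] when the top row has parameter [u] and the left column has parameter
    [v]. *)
Definition boundary (u v : F) (i j : nat) (t l a : int) : F :=
  match i, j with
  | 0, 0 => if a == 1 then u / (1 - s) else (u - v) / (r - s)
  | 0, _ => if l == 1 then (r * u - s * (1 - r)) / (r - s)
            else if a == 1 then u / (1 - s) else (u - (1 - r)) / (r - s)
  | _, 0 => if t == 1 then (r * (1 - s) - s * v) / (r - s)
            else if a == 1 then 1 else ((1 - s) - v) / (r - s)
  | _, _ => 1
  end.

Lemma wtz_bulk u v n i j t l a :
  (i <= n)%N -> (j <= n)%N ->
  (i = 0%N -> t = 0) -> (j = 0%N -> l = 0) ->
  is01 t -> is01 l -> is01 (t + a) -> is01 (l + a) ->
  wtz r s (nth 0 (u :: nseq n (1 - s)) i) (nth 0 (v :: nseq n (1 - r)) j) t l a =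
  bulk t l a * boundary u v i j t l a.
Proof.
move=> le_in le_jn t0 l0 ht hl hta hla; rewrite /wtz ht hl hta hla /=.
have powz (x : F) (b : bool) : x ^+ b = if b then x else 1 by case: b.
have spow t' k : is01 t' -> is01 k -> s ^ (1 - t' - k) =
    if t' == 1 then if k == 1 then s^-1 else 1 else if k == 1 then 1 else s.
  by move=> /orP[]/eqP-> /orP[]/eqP->.
have cases : [/\ t = 0, l = 0 & a = 0] \/ [/\ t = 0, l = 1 & a = 0] \/
  [/\ t = 1, l = 0 & a = 0] \/ [/\ t = 1, l = 1 & a = 0] \/ [/\ t = 0, l = 0 & a = 1] \/
  [/\ t = 1, l = 1 & a = -1].
  have a3 : a = 0 \/ a = 1 \/ a = -1.
    by case/orP: ht => /eqP et; case/orP: hta => /eqP; rewrite et; lia.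
  case: a3 => [ea|[ea|ea]]; move: ht hl hta hla;
    by rewrite ea /is01 => /orP[]/eqP-> /orP[]/eqP-> //= _ _; do ?[by left | right].
have nthE (x y : F) k : (k <= n)%N -> nth 0 (x :: nseq n y) k = if k is 0 then x else y.
  by case: k => // k lt_kn; rewrite /= nth_nseq lt_kn.
rewrite !nthE //.
rewrite /bulk spow // !powz.
have p1 : (1 - s) ^ (1 : int) = 1 - s by [].
have p0 : (1 - s) ^ (0 : int) = 1 by [].
have pN : (1 - s) ^ (-1 : int) = (1 - s)^-1 by [].
move: cases t0 l0; case: i {le_in} => [|i]; case: j {le_jn} => [|j];
  move=> [[-> -> ->]|[[-> -> ->]|[[-> -> ->]|[[-> -> ->]|[[-> -> ->]|[-> -> ->]]]]]] t0 l0;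
  try (by have := t0 erefl); try (by have := l0 erefl);
  by rewrite /= ?(p0, p1, pN); field; rewrite ?s_neq0 ?s_neq1 ?rs_neq.
Qed.

Lemma prod_exprz (x : F) n (e : nat -> int) : x != 0 ->
  \prod_(i < n) x ^ e i = x ^ (\sum_(i < n) e i).
Proof.
move=> xn0; elim: n => [|n IH]; first by rewrite !big_ord0.
by rewrite !big_ord_recr /= IH expfzDr.
Qed.

(** The powers of [s] cancel by [vertex_balance]; the separate factor [(1 - s) ^ a] is raised to the
    sum of all entries, which is [n]. *)
Lemma prod_bulk n (A : 'M[asm_entry]_n) : A \in ASM n ->
  \prod_(i < n) \prod_(j < n)
     bulk (\sum_(k < i) mxf A k j) (\sum_(k < j) mxf A i k) (mxf A i j) =
  (r - s) ^+ (n * n) * (r * s) ^+ `|nu (int_mx A)|%N * ((1 - r) * (1 - s)) ^+ mu (int_mx A) *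
    (1 - s) ^+ n.
Proof.
move=> ASM_A; rewrite nu_vertices // absz_nat mu_vertices.
have e1 : (r - s) ^+ (n * n) = \prod_(i < n) \prod_(j < n) (r - s).
  by rewrite prodr_const card_ord prodr_const card_ord exprM.
have leftS i j : \sum_(k < j) mxf A i k + mxf A i j = \sum_(k < j.+1) mxf A i k.
  by rewrite big_ord_recr.
have e2 : \prod_(i < n) \prod_(j < n)
    s ^ (1 - \sum_(k < i) mxf A k j - (\sum_(k < j) mxf A i k + mxf A i j)) = 1.
  under eq_bigr => i _ do rewrite (prod_exprz n (fun j => 1 - \sum_(k < i) mxf A k j -
     (\sum_(k < j) mxf A i k + mxf A i j))) //.
  rewrite (prod_exprz n (fun i => \sum_(j < n) (1 - \sum_(k < i) mxf A k j -
     (\sum_(k < j) mxf A i k + mxf A i j)))) //.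
  by under eq_bigr do under eq_bigr do rewrite leftS; rewrite vertex_balance.
have e3 : \prod_(i < n) \prod_(j < n) (1 - s) ^ mxf A i j = (1 - s) ^+ n.
  under eq_bigr => i _ do rewrite (prod_exprz n (mxf A i)) // left_full //.
  by rewrite prodr_const card_ord expr1z.
rewrite /bulk; under eq_bigr do rewrite !big_split /=.
rewrite !big_split /= e2 e3 -e1 mulr1; congr (_ * _ * _ * _).
  under eq_bigr do rewrite prodrXr; rewrite prodrXr; congr (_ ^+ _).
  by apply: eq_bigr => i _; apply: eq_bigr => j _; rewrite leftS.
by under eq_bigr do rewrite prodrXr; rewrite prodrXr.
Qed.

(** Both sides say that the corner entry is 1. *)
Lemma trmx_corner n (A : 'M[asm_entry]_n.+1) : A \in ASM n.+1 ->
  (rhoT (int_mx A^T) == 0%N) = (rhoT (int_mx A) == 0%N).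
Proof.
move=> ASM_A; have [_ h] := top_row ASM_A.
have ASM_AT : A^T \in ASM n.+1 by rewrite trmx_ASM.
have [_ h'] := top_row ASM_AT; have := h 0%N isT; have := h' 0%N isT.
rewrite mxf_tr => -> /eqP; rewrite ![0%N == _]eq_sym.
by do 2 case: (_ == 0%N).
Qed.

(** The normalised product of [boundary] for 1's at positions [p] in the top row and [q] in the left
    column: one base for the zeros before the 1, another for those behind it. *)
Definition boundary_factor (u v : F) n (p q : nat) : F :=
  if p == 0%N then ((r * u - s * (1 - r)) * (r * (1 - s) - s * v)) ^+ n
  else (r - s) * (u - v) * ((u - (1 - r)) ^+ p.-1 * (r * u - s * (1 - r)) ^+ (n - p)) *
       (((1 - s) - v) ^+ q.-1 * (r * (1 - s) - s * v) ^+ (n - q)).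

Lemma prod_boundary u v n (A : 'M[asm_entry]_n.+1) : A \in ASM n.+1 ->
  (\prod_(i < n.+1) \prod_(j < n.+1)
     boundary u v i j (\sum_(k < i) mxf A k j) (\sum_(k < j) mxf A i k) (mxf A i j)) *
  (r - s) ^+ (n + n) * (1 - s) =
  u * boundary_factor u v n (rhoT (int_mx A)) (rhoT (int_mx A^T)).
Proof.
move=> ASM_A; have ASM_AT : A^T \in ASM n.+1 by rewrite trmx_ASM.
have [le_pn fE] := top_row ASM_A; have [le_qn gE] := top_row ASM_AT.
rewrite big_ord_recl [\prod_(j < n.+1) _]big_ord_recl.
have -> : boundary u v (ord0 : 'I_n.+1) (ord0 : 'I_n.+1)
   (\sum_(k < (ord0 : 'I_n.+1)) mxf A k (ord0 : 'I_n.+1))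
   (\sum_(k < (ord0 : 'I_n.+1)) mxf A (ord0 : 'I_n.+1) k)
   (mxf A (ord0 : 'I_n.+1) (ord0 : 'I_n.+1)) =
   if rhoT (int_mx A) == 0%N then u / (1 - s) else (u - v) / (r - s).
  by rewrite /= fE //; case: (rhoT _).
have dn : (r - s) ^+ n = \prod_(j < n) (r - s) by rewrite prodr_const card_ord.
have rowE : \prod_(j < n) boundary u v 0 j.+1 (\sum_(k < 0) mxf A k j.+1)
    (\sum_(k < j.+1) mxf A 0 k) (mxf A 0 j.+1) * (r - s) ^+ n =
  if rhoT (int_mx A) == 0%N then (r * u - s * (1 - r)) ^+ n
  else (u - (1 - r)) ^+ (rhoT (int_mx A)).-1 * (u / (1 - s)) * (r - s) *
    (r * u - s * (1 - r)) ^+ (n - rhoT (int_mx A)).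
  have bE j : (j < n)%N -> boundary u v 0 j.+1 (\sum_(k < 0) mxf A k j.+1)
      (\sum_(k < j.+1) mxf A 0 k) (mxf A 0 j.+1) * (r - s) =
    if (rhoT (int_mx A) <= j)%N then r * u - s * (1 - r)
    else if j.+1 == rhoT (int_mx A) then u / (1 - s) * (r - s) else u - (1 - r).
    move=> lt_jn; rewrite /boundary (left_top_row ASM_A (ltnW lt_jn : (j.+1 <= n.+1)%N)) fE // ltnS.
    case: leqP => _; rewrite /= ?divfK //.
    by case: (j.+1 == _); rewrite /= ?divfK.
  rewrite dn -big_split (eq_bigr _ (fun (j : 'I_n) _ => bE j (ltn_ord j))).
  case: (rhoT _) le_pn => [|p] lt_pn /=; first by rewrite prodr_const card_ord.
  rewrite -[_ * (u / _) * _]mulrA -(prod_position _ _ _ lt_pn); apply: eq_bigr => j _.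
  by rewrite eqSS; case: ltngtP.
have colE : \prod_(i < n) boundary u v i.+1 0 (\sum_(k < i.+1) mxf A k 0)
    (\sum_(k < 0) mxf A i.+1 k) (mxf A i.+1 0) * (r - s) ^+ n =
  if rhoT (int_mx A) == 0%N then (r * (1 - s) - s * v) ^+ n
  else ((1 - s) - v) ^+ (rhoT (int_mx A^T)).-1 * (r - s) *
    (r * (1 - s) - s * v) ^+ (n - rhoT (int_mx A^T)).
  have bE i : (i < n)%N -> boundary u v i.+1 0 (\sum_(k < i.+1) mxf A k 0)
      (\sum_(k < 0) mxf A i.+1 k) (mxf A i.+1 0) * (r - s) =
    if (rhoT (int_mx A^T) <= i)%N then r * (1 - s) - s * v
    else if i.+1 == rhoT (int_mx A^T) then r - s else (1 - s) - v.
    move=> lt_in; rewrite /boundary.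
    have -> : \sum_(k < i.+1) mxf A k 0 = (rhoT (int_mx A^T) < i.+1)%N%:Z.
      rewrite -(left_top_row ASM_AT (ltnW lt_in : (i.+1 <= n.+1)%N)).
      by apply: eq_bigr => k _; rewrite mxf_tr.
    rewrite -mxf_tr gE // ltnS; case: leqP => _; rewrite /= ?divfK //.
    by case: (i.+1 == _); rewrite /= ?divfK ?mul1r.
  rewrite dn -big_split (eq_bigr _ (fun (j : 'I_n) _ => bE j (ltn_ord j))).
  rewrite -(trmx_corner ASM_A).
  case: (rhoT _) le_qn => [|p] lt_pn /=; first by rewrite prodr_const card_ord.
  rewrite -(prod_position _ _ _ lt_pn); apply: eq_bigr => j _.
  by rewrite eqSS; case: ltngtP.
have -> : \prod_(i < n) \prod_(j < n.+1) boundary u v (lift ord0 i) j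
     (\sum_(k < lift ord0 i) mxf A k j) (\sum_(k < j) mxf A (lift ord0 i) k) (mxf A (lift ord0 i) j) =
   \prod_(i < n) boundary u v i.+1 0 (\sum_(k < i.+1) mxf A k 0)
    (\sum_(k < 0) mxf A i.+1 k) (mxf A i.+1 0).
  by apply: eq_bigr => i _; rewrite big_ord_recl [X in _ * X]big1 ?mulr1 // => j _.
rewrite exprD.
have key (c P Q e X Y : F) : P * e = X -> Q * e = Y ->
    c * P * Q * (e * e) * (1 - s) = c * X * Y * (1 - s).
  by move=> <- <-; ring.
rewrite (key _ _ _ _ _ _ rowE colE) /boundary_factor.
case: eqP => [_|/eqP pn0]; first by rewrite exprMn; field.
move: ((u - _) ^+ _) ((1 - s - v) ^+ _) (_ ^+ (n - rhoT (int_mx A)))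
  (_ ^+ (n - rhoT (int_mx A^T))) => a b c e.
by field; rewrite rs_neq s_neq1.
Qed.

Lemma vertex_weights_ASM u v n (A : 'M[asm_entry]_n.+1) : A \in ASM n.+1 ->
  vertex_weights r s (u :: nseq n (1 - s)) (v :: nseq n (1 - r)) n.+1 (mxf A) =
  u * (r - s) ^+ (n * n).+1 * (1 - s) ^+ n *
  ((r * s) ^+ `|nu (int_mx A)|%N * ((1 - r) * (1 - s)) ^+ mu (int_mx A) *
   boundary_factor u v n (rhoT (int_mx A)) (rhoT (int_mx A^T))).
Proof.
move=> ASM_A; rewrite /vertex_weights.
have pN0 : (r - s) ^+ (n + n) * (1 - s) != 0 by rewrite mulf_neq0 ?expf_neq0.
apply: (mulIf pN0).
have -> : \prod_(i < n.+1) \prod_(j < n.+1)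
    wtz r s (nth 0 (u :: nseq n (1 - s)) i) (nth 0 (v :: nseq n (1 - r)) j)
      (\sum_(k < i) mxf A k j) (\sum_(k < j) mxf A i k) (mxf A i j) =
  (\prod_(i < n.+1) \prod_(j < n.+1)
     bulk (\sum_(k < i) mxf A k j) (\sum_(k < j) mxf A i k) (mxf A i j)) *
  (\prod_(i < n.+1) \prod_(j < n.+1)
     boundary u v i j (\sum_(k < i) mxf A k j) (\sum_(k < j) mxf A i k) (mxf A i j)).
  rewrite -big_split; apply: eq_bigr => i _; rewrite -big_split; apply: eq_bigr => j _.
  have li := ltn_ord i; have lj := ltn_ord j.
  have topS : \sum_(k < i) mxf A k j + mxf A i j = \sum_(k < i.+1) mxf A k j by rewrite big_ord_recr.
  have leftS : \sum_(k < j) mxf A i k + mxf A i j = \sum_(k < j.+1) mxf A i k by rewrite big_ord_recr.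
  apply: (@wtz_bulk _ _ n) => //; rewrite ?topS ?leftS ?top01 ?left01 ?(ltnW li) ?(ltnW lj) //.
    by move=> ->; rewrite big_ord0.
  by move=> ->; rewrite big_ord0.
rewrite prod_bulk //; have := prod_boundary u v ASM_A.
set B := \prod_(i < n.+1) _; move: (boundary_factor _ _ _ _ _) => bf.
rewrite -!mulrA; move: B => B eB; rewrite [in B * _]eB.
have -> : (n.+1 * n.+1)%N = ((n * n).+1 + (n + n))%N by lia.
by rewrite exprD [(1 - s) ^+ n.+1]exprSr; ring.
Qed.

End WeightOfASM.

(** * The recurrence *)

(** Transposition swaps the top and right edges with the left and bottom ones; either pair being 1
    forces all four to be 1. *)
Lemma nu_tr n (A : 'M[asm_entry]_n) : A \in ASM n -> nu (int_mx A^T) = nu (int_mx A).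
Proof.
move=> ASM_A; have ASM_AT : A^T \in ASM n by rewrite trmx_ASM.
rewrite !nu_vertices //; congr Posz; rewrite exchange_big; apply: eq_bigr => i _; apply: eq_bigr => j _.
have li := ltn_ord i; have lj := ltn_ord j.
have -> : \sum_(k < j) mxf A^T k i = \sum_(k < j) mxf A i k.
  by apply: eq_bigr => k _; rewrite mxf_tr.
have -> : \sum_(k < i.+1) mxf A^T j k = \sum_(k < i.+1) mxf A k j.
  by apply: eq_bigr => k _; rewrite mxf_tr.
have := top01 ASM_A li lj; have := left01 ASM_A li lj.
have := top01 ASM_A (ltnW li) lj; have := left01 ASM_A li (ltnW lj).
rewrite !big_ord_recr /=; have := mxf_in A i j; rewrite !inE.
by move=> /or3P[]/eqP-> /orP[]/eqP-> /orP[]/eqP->.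
Qed.

Lemma mu_tr n (A : 'M[asm_entry]_n) : mu (int_mx A^T) = mu (int_mx A).
Proof.
rewrite !mu_vertices exchange_big; apply: eq_bigr => i _; apply: eq_bigr => j _.
by rewrite mxf_tr.
Qed.

Section AdjacentGeneratingFunctions.
Variable R : comNzRingType.
Implicit Types x y z w : R.

Definition asm_weight n x y (A : 'M[asm_entry]_n) : R :=
  x ^+ `|nu (int_mx A)|%N * y ^+ mu (int_mx A).

Definition Zadj n x y z w : R :=
  \sum_(A in ASM n) asm_weight x y A * (z ^+ rhoT (int_mx A) * w ^+ rhoT (int_mx A^T)).

(** This is X_n(z, w): position 0 means that the corner entry is 1. *)
Definition Zoff n x y z w : R :=
  \sum_(A in ASM n | rhoT (int_mx A) != 0%N)
    asm_weight x y A * (z ^+ rhoT (int_mx A) * w ^+ rhoT (int_mx A^T)).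

Lemma Zadj_left n x y z : Zadj n x y z 1 = (Zref n x y).[z].
Proof.
rewrite /Zref horner_sum; apply: eq_bigr => A _.
by rewrite expr1n mulr1 hornerZ hornerXn.
Qed.

Lemma Zadj_tr n x y z w : Zadj n x y z w = Zadj n x y w z.
Proof.
rewrite /Zadj (reindex_inj (@trmx_inj _ n n)) /=; apply: eq_big => A; rewrite trmx_ASM // => ASM_A.
by rewrite /asm_weight nu_tr // mu_tr trmxK [X in _ * X]mulrC.
Qed.

Lemma Zadj_right n x y w : Zadj n x y 1 w = (Zref n x y).[w].
Proof. by rewrite Zadj_tr Zadj_left. Qed.

Lemma Zadj11 n x y : Zadj n x y 1 1 = Z n x y.
Proof. exact: Zadj_left. Qed.

End AdjacentGeneratingFunctions.

Lemma succ_square n : (n.+1 * n.+1)%N = ((n * n).+1 + (n + n))%N.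
Proof. by lia. Qed.

Section HomogeneousPartitionFunction.
Variables (F : fieldType) (r s : F).
Hypotheses (r_neq0 : r != 0) (s_neq0 : s != 0) (r_neq1 : 1 - r != 0) (s_neq1 : 1 - s != 0).
Hypothesis rs_neq : r - s != 0.
Local Notation x := (r * s).
Local Notation y := ((1 - r) * (1 - s)).
Local Notation U := (1 - s).
Local Notation V := (1 - r).
Local Notation d := (r - s).

Lemma dwpf_refined n u v : dwpf r s (u :: nseq n U) (v :: nseq n V) =
  u * d ^+ (n * n).+1 * U ^+ n * \sum_(A in ASM n.+1)
    asm_weight x y A * boundary_factor r s u v n (rhoT (int_mx A)) (rhoT (int_mx A^T)).
Proof.
rewrite (@dwpf_ASM _ _ _ n.+1) /= ?size_nseq // mulr_sumr.
by apply: eq_bigr => A ASM_A; rewrite vertex_weights_ASM.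
Qed.

(** [z] and [w] are the ratios of the weights of zeros before and behind the 1, in the top row and
    in the left column. Thus [boundary_factor] yields powers of [z] and [w] that record the
    positions. *)
Lemma dwpf_zw n u v z w : r * u - s * V != 0 -> r * U - s * v != 0 -> z != 0 -> w != 0 ->
  u - V = z * (r * u - s * V) -> U - v = w * (r * U - s * v) ->
  dwpf r s (u :: nseq n U) (v :: nseq n V) =
  u * d ^+ (n * n).+1 * U ^+ n * ((r * u - s * V) * (r * U - s * v)) ^+ n *
  (Zadj n.+1 x y z w - (1 - z) * (1 - w) / (z * w * y) * Zoff n.+1 x y z w).
Proof.
move=> bu0 bv0 z0 w0 ez ew; rewrite dwpf_refined -[RHS]mulrA; congr (_ * _).
rewrite /Zoff /Zadj big_mkcondr /= mulr_sumr -sumrB mulr_sumr; apply: eq_bigr => A ASM_A.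
have [lep _] := top_row ASM_A.
have ASM_AT : A^T \in ASM n.+1 by rewrite trmx_ASM.
have [leq _] := top_row ASM_AT.
have := trmx_corner ASM_A; move: lep leq; rewrite /boundary_factor.
case: (rhoT (int_mx A)) => [|p] lep; case: (rhoT (int_mx A^T)) => [|q] leq //= _.
  by rewrite !expr0 !mulr1 mulr0 subr0 mulrC.
rewrite ez ew; set bu := r * u - _; set bv := _ - s * v.
have ez' : (1 - z) * bu = V * (U - u) by rewrite mulrBl -ez /bu; ring.
have ew' : (1 - w) * bv = U * (v - V) by rewrite mulrBl -ew /bv; ring.
(* The corner factor in terms of [z] and [w]; its second term produces [Zoff]. *)
have corner : d * (u - v) = z * w * (bu * bv) - ((1 - z) * bu) * ((1 - w) * bv) / y.
  transitivity ((z * bu) * (w * bv) - ((1 - z) * bu) * ((1 - w) * bv) / y); last by ring.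
  rewrite ez' ew' -ez -ew; field; by rewrite s_neq1 r_neq1.
have split_pow (b : F) k : (k < n.+1)%N -> (0 < k)%N -> b ^+ n = b ^+ (n - k) * (b ^+ k.-1 * b).
  by case: k => // k lt_kn _; rewrite -exprSr -exprD subnK.
rewrite corner !exprMn (split_pow bu p.+1) // (split_pow bv q.+1) //= !exprS.
move: (bu ^+ (n - _)) (bv ^+ (n - _)) => b1 b2.
move: (z ^+ p) (bu ^+ p) (w ^+ q) (bv ^+ q) (asm_weight _ _ _) => a1 a2 a3 a4 a5.
by field; rewrite z0 w0 s_neq1 r_neq1.
Qed.

Lemma dwpf_bulk n : dwpf r s (nseq n U) (nseq n V) = U ^+ n * d ^+ (n * n) * Z n x y.
Proof.
case: n => [|n]; first by rewrite Z0 /dwpf /= !mulr1.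
have e1 : r * U - s * V = d by ring.
rewrite (@dwpf_zw n U V 1 1) ?e1 ?oner_neq0 ?mul1r //; try by ring.
rewrite subrr !mul0r subr0 Zadj11 exprMn.
rewrite succ_square.
by rewrite !exprD !exprS; ring.
Qed.

(* At [u = v] the corner is frozen to the entry 1. *)
Lemma sum_corner n :
  \sum_(A in ASM n.+1 | rhoT (int_mx A) == 0%N) asm_weight x y A = Z n x y.
Proof.
have e1 : r * U - s * V = d by ring.
have := dwpf_refined n U U; rewrite pf_frozen_corner dwpf_bulk.
rewrite (eq_big_seq (fun=> d)); last by move=> v /nseqP[-> _]; rewrite e1.
rewrite [\prod_(w <- nseq n U) _](eq_big_seq (fun=> d * U)); last first.
  by move=> v /nseqP[-> _]; ring.
rewrite !big_const_seq !count_predT !size_nseq !iter_mulr_1.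
have -> : \sum_(A in ASM n.+1) asm_weight x y A *
    boundary_factor r s U U n (rhoT (int_mx A)) (rhoT (int_mx A^T)) =
    (d * (d * U)) ^+ n * \sum_(A in ASM n.+1 | rhoT (int_mx A) == 0%N) asm_weight x y A.
  rewrite [in RHS]big_mkcondr mulr_sumr; apply: eq_bigr => A _; rewrite /boundary_factor.
  case: ifP => _; last by rewrite subrr mulr0 !mul0r !mulr0.
  by rewrite e1 mulrC; congr (_ ^+ _ * _); ring.
move=> e; have c0 : U * d ^+ (n * n).+1 * U ^+ n * (d * (d * U)) ^+ n != 0.
  by rewrite !mulf_neq0 ?expf_neq0 ?mulf_neq0.
apply: (mulfI c0); rewrite -[LHS]mulrA -e !exprMn exprS; ring.
Qed.

Lemma Zadj_split n z w : Zadj n.+1 x y z w = Z n x y + Zoff n.+1 x y z w.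
Proof.
rewrite -sum_corner /Zadj /Zoff (bigID (fun A => rhoT (int_mx A) == 0%N)) /=; congr (_ + _).
apply: eq_bigr => A /andP[ASM_A rho0]; have := trmx_corner ASM_A.
by rewrite rho0 => /eqP ->; rewrite (eqP rho0) !expr0 !mulr1.
Qed.

(** This is [dwpf_bilinear] with row parameters [u], [U] and column parameters [v], [V], all further
    ones being [U] and [V], rewritten by [dwpf_zw]. *)
Lemma Zoff_bilinear n z w : z != 0 -> w != 0 -> 1 - z * r != 0 -> 1 - w * s != 0 ->
  1 - z * s != 0 -> (1 - z) * (1 - w) - z * w * y != 0 -> 
  (1 - z) * (1 - w) * Zoff n.+2 x y z w * Z n x y =
  z * w * (y * (Z n x y + Zoff n.+1 x y z w) * Z n.+1 x y +
    (x * (1 - z) * (1 - w) - y) * ((Zref n.+1 x y).[z] * (Zref n.+1 x y).[w])).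
Proof.
move=> z0 w0 zr ws zs e0.
(* These solve the ratio equations [ez] and [ew] below. *)
pose u := V * (1 - z * s) / (1 - z * r); pose v := U * (1 - w * r) / (1 - w * s).
have bu : r * u - s * V = V * d / (1 - z * r) by rewrite /u; field.
have bv : r * U - s * v = U * d / (1 - w * s) by rewrite /v; field.
have bu0 : r * u - s * V != 0 by rewrite bu !mulf_neq0 ?invr_neq0.
have bv0 : r * U - s * v != 0 by rewrite bv !mulf_neq0 ?invr_neq0.
have ez : u - V = z * (r * u - s * V) by rewrite bu /u; field.
have ew : U - v = w * (r * U - s * v) by rewrite bv /v; field.
have e1 : r * U - s * V = d by ring.
have bil := @dwpf_bilinear F r s u U v V (nseq n U) (nseq n V) r_neq0 _.
rewrite !size_nseq in bil; move: (bil erefl) => {}bil.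
have S2 := dwpf_zw n.+1 bu0 bv0 z0 w0 ez ew.
have S1 := dwpf_zw n bu0 bv0 z0 w0 ez ew.
have Sz : dwpf r s (u :: nseq n U) (V :: nseq n V) =
  u * d ^+ (n * n).+1 * U ^+ n * ((r * u - s * V) * d) ^+ n * (Zref n.+1 x y).[z].
  rewrite (@dwpf_zw n u V z 1) ?e1 ?oner_neq0 ?mul1r //; last by ring.
  by rewrite subrr mulr0 !mul0r subr0 Zadj_left.
have Sw : dwpf r s (U :: nseq n U) (v :: nseq n V) =
  U * d ^+ (n * n).+1 * U ^+ n * (d * (r * U - s * v)) ^+ n * (Zref n.+1 x y).[w].
  rewrite (@dwpf_zw n U v 1 w) ?e1 ?oner_neq0 ?mul1r //; last by ring.
  by rewrite subrr !mul0r subr0 Zadj_right.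
have S11 := dwpf_bulk n.+1; have S0 := dwpf_bulk n.
rewrite /= in S2 S11 bil; rewrite S2 S0 S1 S11 Sz Sw in bil.
rewrite !Zadj_split in bil.
have un0 : u != 0 by rewrite /u !mulf_neq0 ?invr_neq0.
have y0 : y != 0 by rewrite mulf_neq0.
have Uu : U - u = (1 - z) * (r * u - s * V) / V by rewrite mulrBl -ez; field.
have vV : v - V = (1 - w) * (r * U - s * v) / U by rewrite mulrBl -ew; field.
have uv : u - v = (z * w - (1 - z) * (1 - w) / y) * ((r * u - s * V) * (r * U - s * v)) / d.
  by rewrite bu bv /u /v; field; rewrite zr ws rs_neq r_neq1 s_neq1.
have ruv : r * u - s * v =
    (y - x * ((1 - z) * (1 - w))) * ((r * u - s * V) * (r * U - s * v)) / (y * d).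
  by rewrite bu bv /u /v; field; rewrite zr ws rs_neq r_neq1 s_neq1.
rewrite uv ruv Uu vV ez ew e1 in bil.
have UV : U - V = d by ring.
rewrite UV in bil.
rewrite succ_square !(exprS, exprD, exprMn) in bil.
move: bu0 bv0 bil (expf_neq0 n bu0) (expf_neq0 n bv0) (expf_neq0 n rs_neq) (expf_neq0 (n * n) rs_neq)
   (expf_neq0 n s_neq1).
move: (d ^+ (n * n)) (d ^+ n) (U ^+ n) ((r * u - s * V) ^+ n) ((r * U - s * v) ^+ n).
move: (r * u - s * V) (r * U - s * v) => Bu Bv D e Un Bun Bvn.
move: (Z n _ _) (Z n.+1 _ _) (Zoff _ _ _ _ _) (Zoff _ _ _ _ _) (_.[z]) (_.[w]) => Z0 Z1 X1 X2 Zz Zw.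
move=> Bu0 Bv0 bil Bun0 Bvn0 e00 D0 Un0.
clear S1 Sz Sw S0 S2 S11 ez ew bu bv Uu vV uv ruv UV e1 zr ws zs; move: u un0 bil => {}u un0 {v} bil.
pose q := (1 - z) * (1 - w).
(* [c] removes the common factors from [bil]; up to nonzero factors, [q - z * w * y] is [u - v]. *)
pose c := - (z * w * y ^+ 2) / ((q - z * w * y) *
  (u * U * Un ^+ 2 * d ^+ 2 * D ^+ 2 * e ^+ 2 * (Bu * Bv) ^+ 2 * Bun * Bvn)).
apply/eqP; rewrite -subr_eq0; apply/eqP.
lazymatch type of bil with ?L = ?R => transitivity (c * (L - R)) end.
  rewrite /c /q; field.
  by rewrite e0 z0 w0 r_neq1 s_neq1 rs_neq Bu0 Bv0 Bun0 Bvn0 e00 D0 Un0 un0.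
by rewrite bil subrr mulr0.
Qed.

End HomogeneousPartitionFunction.

(** * Taylor coefficients at z = w = 1 *)

Section NegativeBinomialCoefficients.
Variable R : comNzRingType.
Implicit Types (p q : {poly R}) (c : R).

(* The coefficient of [t ^ i] in [(1 - t)^-m * p(1 - t)], for [size p <= m]. *)
Definition negbin m i p : R := \sum_(j < m) p`_j * 'C(m - j.+1 + i, i)%:R.

Lemma negbinD m i p q : negbin m i (p + q) = negbin m i p + negbin m i q.
Proof. by rewrite -big_split; apply: eq_bigr => j _; rewrite coefD mulrDl. Qed.

Lemma negbinZ m i c p : negbin m i (c%:P * p) = c * negbin m i p.
Proof. by rewrite mulr_sumr; apply: eq_bigr => j _; rewrite coefCM mulrA. Qed.

Lemma negbinZr m i c p : negbin m i (p * c%:P) = c * negbin m i p.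
Proof. by rewrite mulrC negbinZ. Qed.

Lemma negbinB m i p q : negbin m i (p - q) = negbin m i p - negbin m i q.
Proof. by rewrite negbinD -mulN1r -polyC1 -polyCN negbinZ mulN1r. Qed.

Lemma negbin_sum m i (I : Type) (l : seq I) (P : pred I) (G : I -> {poly R}) :
  negbin m i (\sum_(k <- l | P k) G k) = \sum_(k <- l | P k) negbin m i (G k).
Proof.
apply: (big_morph (negbin m i)) => [p q|]; first exact: negbinD.
by rewrite /negbin big1 // => j _; rewrite coef0 mul0r.
Qed.

(** ['X] stands for [1 - t] and cancels one power of the denominator. *)
Lemma negbin_mulX m i p : negbin m.+1 i ('X * p) = negbin m i p.
Proof.
rewrite /negbin big_ord_recl coefXM mul0r add0r; apply: eq_bigr => j _.
by rewrite coefXM.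
Qed.

(** [1 - 'X] stands for [t] and shifts the coefficient; on the binomials this is Pascal's rule. *)
Lemma negbin_mul1BX m i p : negbin m i.+1 ((1 - 'X) * p) = negbin m i p.
Proof.
rewrite mulrBl mul1r negbinB; case: m => [|m]; first by rewrite /negbin !big_ord0 subr0.
rewrite negbin_mulX /negbin !big_ord_recr /= subnn !add0n !binn addrAC -sumrB; congr (_ + _).
apply: eq_bigr => j _; rewrite -mulrBr; congr (_ * _).
have -> : (m.+1 - j.+1 = (m - j.+1).+1)%N by rewrite subSS subnSK.
by rewrite !addSn !addnS binS natrD addrAC subrr add0r.
Qed.

Lemma negbinXn m i k : (k < m)%N -> negbin m i 'X^k = 'C(m - k.+1 + i, i)%:R.
Proof.
move=> lt_km; rewrite /negbin (bigD1 (Ordinal lt_km)) //= big1 => [|j neq].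
  by rewrite coefXn eqxx mul1r addr0.
by rewrite coefXn -[_ == _ :> nat]/(j == Ordinal lt_km) (negbTE neq) mul0r.
Qed.

Lemma negbin_one m i : negbin m.+1 i 1 = 'C(m + i, i)%:R.
Proof. by rewrite -(expr0 'X) negbinXn // subn1. Qed.

End NegativeBinomialCoefficients.

Lemma negbin_map (R : comNzRingType) m i (p : {poly R}) :
  negbin m i (map_poly polyC p) = (negbin m i p)%:P.
Proof.
rewrite /negbin raddf_sum; apply: eq_bigr => j _.
by rewrite coef_map /= polyCM polyC_natr.
Qed.

Section DoubleCoefficients.
Variable R : comNzRingType.
Implicit Types (P Q : {poly {poly R}}) (p q : {poly R}) (c : R).

(** The outer variable is [w], the inner one [z]; the same coefficient is taken in both. *)
Definition negbin2 m i P : R := negbin m i (negbin m i P).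

Lemma negbin2D m i P Q : negbin2 m i (P + Q) = negbin2 m i P + negbin2 m i Q.
Proof. by rewrite /negbin2 !negbinD. Qed.

Lemma negbin2B m i P Q : negbin2 m i (P - Q) = negbin2 m i P - negbin2 m i Q.
Proof. by rewrite /negbin2 !negbinB. Qed.

Lemma negbin2Z m i c P : negbin2 m i (c%:P%:P * P) = c * negbin2 m i P.
Proof. by rewrite /negbin2 !negbinZ. Qed.

Lemma negbin2_sum m i (I : Type) (l : seq I) (p : pred I) (G : I -> {poly {poly R}}) :
  negbin2 m i (\sum_(k <- l | p k) G k) = \sum_(k <- l | p k) negbin2 m i (G k).
Proof.
have e := negbin_sum m i l p G.
by rewrite /negbin2 e; apply: negbin_sum.
Qed.

Lemma negbin2_mulX m i P : negbin2 m.+1 i ('X%:P * 'X * P) = negbin2 m i P.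
Proof. by rewrite /negbin2 -mulrA negbinZ !negbin_mulX. Qed.

Lemma negbin2_mul1BX m i P : negbin2 m i.+1 ((1 - 'X%:P) * (1 - 'X) * P) = negbin2 m i P.
Proof. by rewrite /negbin2 -polyC1 -polyCB polyC1 -mulrA negbinZ !negbin_mul1BX. Qed.

Lemma negbin2_prod m i p q : negbin2 m i (p%:P * map_poly polyC q) = negbin m i p * negbin m i q.
Proof. by rewrite /negbin2 negbinZ negbin_map negbinZr mulrC. Qed.

Lemma negbin2_one m i : negbin2 m.+1 i 1 = 'C(m + i, i)%:R ^+ 2.
Proof.
have := negbin2_prod m.+1 i 1 1; rewrite !polyC1 rmorph1 mul1r => ->.
by rewrite negbin_one.
Qed.

Lemma negbin2_monomial m c k l : (k < m)%N -> (l < m)%N ->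
  negbin2 m 0 (c%:P%:P * ('X%:P ^+ k * 'X ^+ l)) = c.
Proof.
move=> lt_km lt_lm; rewrite negbin2Z -polyC_exp -(map_polyXn polyC) negbin2_prod !negbinXn // !bin0.
by rewrite !mulr1.
Qed.

End DoubleCoefficients.

Section GeneratingFunctionMorphisms.
Variables (R R' : comNzRingType) (f : {rmorphism R -> R'}).
Implicit Types x y z w : R.

Lemma asm_weight_morph n x y (A : 'M[asm_entry]_n) :
  f (asm_weight x y A) = asm_weight (f x) (f y) A.
Proof. by rewrite /asm_weight rmorphM !rmorphXn. Qed.

Lemma Zadj_morph n x y z w : f (Zadj n x y z w) = Zadj n (f x) (f y) (f z) (f w).
Proof.
rewrite /Zadj rmorph_sum; apply: eq_bigr => A _.
by rewrite rmorphM asm_weight_morph rmorphM !rmorphXn.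
Qed.

Lemma Zoff_morph n x y z w : f (Zoff n x y z w) = Zoff n (f x) (f y) (f z) (f w).
Proof.
rewrite /Zoff rmorph_sum; apply: eq_bigr => A _.
by rewrite rmorphM asm_weight_morph rmorphM !rmorphXn.
Qed.

Lemma Z_morph n x y : f (Z n x y) = Z n (f x) (f y).
Proof. by rewrite -!Zadj11 Zadj_morph !rmorph1. Qed.

Lemma Zref_morph n x y : map_poly f (Zref n x y) = Zref n (f x) (f y).
Proof.
rewrite /Zref rmorph_sum; apply: eq_bigr => A _ /=.
by rewrite map_polyZ map_polyXn rmorphM !rmorphXn.
Qed.

End GeneratingFunctionMorphisms.

Lemma Zref_Zadj (R : comNzRingType) n (x y : R) : Zadj n x%:P y%:P 'X 1 = Zref n x y.
Proof.
apply: eq_bigr => A _; rewrite expr1n mulr1 /asm_weight -!polyC_exp -polyCM.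
by rewrite mul_polyC.
Qed.

Section CoefficientRecurrence.
Variables (F : fieldType) (r s : F).
Hypotheses (r_neq0 : r != 0) (s_neq0 : s != 0) (r_neq1 : 1 - r != 0) (s_neq1 : 1 - s != 0).
Hypothesis rs_neq : r - s != 0.
Let x := r * s.
Let y := (1 - r) * (1 - s).
Local Notation iota c := (c%:P%:P : {poly {poly F}}).

(** [Zoff_bilinear] holds in the fraction field, where its conditions on [z] and [w] are automatic,
    and is pulled back along the embedding. *)
Lemma Zoff_bilinear_poly n (z := 'X%:P : {poly {poly F}}) (w := 'X : {poly {poly F}}) :
  (1 - z) * (1 - w) * Zoff n.+2 (iota x) (iota y) z w * iota (Z n x y) =
  z * w * (iota y * (iota (Z n x y) + Zoff n.+1 (iota x) (iota y) z w) * iota (Z n.+1 x y) +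
    (iota x * (1 - z) * (1 - w) - iota y) *
     ((Zref n.+1 x y)%:P * map_poly polyC (Zref n.+1 x y))).
Proof.
pose phi : {rmorphism {poly {poly F}} -> {fraction {poly {poly F}}}} := @tofrac _.
have phi_eq0 p : (phi p == 0) = (p == 0) by apply: tofrac_eq0.
have phiI : injective phi by move=> p q /eqP; rewrite tofrac_eq => /eqP.
(* All conditions involving constants are met because the value at z = w = 0 is 1. *)
have neq0 p : p.[0].[0] = 1 -> phi p != 0.
  by move=> e; rewrite phi_eq0; apply: contra_eq_neq e => ->; rewrite !horner0 eq_sym oner_neq0.
have cn0 c : c != 0 -> phi (iota c) != 0 by rewrite phi_eq0 !polyC_eq0.
pose r' := phi (iota r); pose s' := phi (iota s).
have r0' : r' != 0 by apply: cn0.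
have s0' : s' != 0 by apply: cn0.
have ex : r' * s' = phi (iota x) by rewrite -rmorphM -!polyCM.
have er1 : 1 - r' = phi (iota (1 - r)) by rewrite !polyCB !polyC1 rmorphB rmorph1.
have es1 : 1 - s' = phi (iota (1 - s)) by rewrite !polyCB !polyC1 rmorphB rmorph1.
have ey : (1 - r') * (1 - s') = phi (iota y) by rewrite er1 es1 -rmorphM -!polyCM.
have ers : r' - s' = phi (iota (r - s)) by rewrite !polyCB rmorphB.
have r1' : 1 - r' != 0 by rewrite er1 cn0.
have s1' : 1 - s' != 0 by rewrite es1 cn0.
have rs' : r' - s' != 0 by rewrite ers cn0.
have := @Zoff_bilinear _ r' s' r0' s0' r1' s1' rs' n (phi z) (phi w).
rewrite -!Zadj_left ex ey.
have -> : Zadj n.+1 (phi (iota x)) (phi (iota y)) (phi w) 1 = phi (map_poly polyC (Zref n.+1 x y)).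
  by rewrite -(rmorph1 phi) -Zadj_morph (Zref_morph polyC) Zref_Zadj.
have -> : Zadj n.+1 (phi (iota x)) (phi (iota y)) (phi z) 1 = phi (Zref n.+1 x y)%:P.
  by rewrite -(rmorph1 phi) -Zadj_morph -Zref_Zadj (Zadj_morph polyC) rmorph1.
have ZE m : Z m (phi (iota x)) (phi (iota y)) = phi (iota (Z m x y)).
  by rewrite !(Z_morph polyC) Z_morph.
rewrite -!Zoff_morph !ZE -(rmorph1 phi) -!(rmorphB, rmorphM, rmorphD).
move=> h; apply: phiI; apply: h.
- by rewrite phi_eq0 polyC_eq0 polyX_eq0.
- by rewrite phi_eq0 polyX_eq0.
- by apply: neq0; rewrite !(hornerE, subr0).
- by apply: neq0; rewrite !(hornerE, subr0).
- by apply: neq0; rewrite !(hornerE, subr0).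
by apply: neq0; rewrite !(hornerE, subr0).
Qed.

(* The diagonal coefficient of [(1 - z) ^ i (1 - w) ^ i] in [(z w)^-n X_n(z, w)]. *)
Definition Eoff n i : F := negbin2 n i (Zoff n (iota x) (iota y) 'X%:P 'X).

(** The coefficient of [(1 - z) ^ i] in [z^-n Z_n(z)]; these become the sums over [j] in the
    theorem. *)
Definition refined_sum n i : F := negbin n i (Zref n x y).

Lemma Eoff_rec n i :
  Eoff n.+2 i * Z n x y =
  y * Z n.+1 x y * (Eoff n.+1 i.+1 + Z n x y * 'C(n + i.+1, i.+1)%:R ^+ 2) +
  x * refined_sum n.+1 i ^+ 2 - y * refined_sum n.+1 i.+1 ^+ 2.
Proof.
(* On the left [(1 - z) (1 - w)] lowers [i.+1] to [i]; on the right [z w] lowers [n.+2] to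
   [n.+1]. *)
have := congr1 (negbin2 n.+2 i.+1) (Zoff_bilinear_poly n).
rewrite mulrC negbin2Z negbin2_mul1BX negbin2_mulX.
set p := Zref _ _ _; set P := Zoff _ _ _ _ _; set Q := Zoff _ _ _ _ _ => e.
rewrite mulrC e.
have -> : iota y * (iota (Z n x y) + Q) * iota (Z n.+1 x y) +
    (iota x * (1 - 'X%:P) * (1 - 'X) - iota y) * (p%:P * map_poly polyC p) =
  iota (y * Z n.+1 x y) * Q + iota (y * Z n.+1 x y * Z n x y) * 1 +
  iota x * ((1 - 'X%:P) * (1 - 'X) * (p%:P * map_poly polyC p)) -
  iota y * (p%:P * map_poly polyC p).
  by rewrite !polyCM; ring.
rewrite negbin2B !negbin2D !negbin2Z negbin2_mul1BX !negbin2_prod negbin2_one.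
by rewrite /Eoff /refined_sum -/p -/Q; ring.
Qed.

Lemma Eoff1 i : Eoff 1 i = 0.
Proof.
rewrite /Eoff /Zoff big1 => [|A /andP[ASM_A]].
  by have := negbin2Z 1 i (0 : F) 0; rewrite mulr0 mul0r.
by have [] := top_row ASM_A; rewrite leqn0 => ->.
Qed.

(** The coefficient of index 0 is the value at z = w = 1, where [Zadj_split] applies. *)
Lemma Eoff0 n : Eoff n.+1 0 = Z n.+1 x y - Z n x y.
Proof.
rewrite -(Zadj11 n.+1) (@Zadj_split F r s) // -/x -/y addrC addKr.
rewrite /Eoff /Zoff negbin2_sum; apply: eq_bigr => A /andP[ASM_A _].
have [le_p _] := top_row ASM_A.
have [le_q _] : (rhoT (int_mx A^T) <= n)%N /\ _ := top_row (etrans (trmx_ASM A) ASM_A).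
rewrite !expr1n !mulr1 -(asm_weight_morph polyC) -(asm_weight_morph polyC).
by rewrite negbin2_monomial.
Qed.

Hypothesis Z_neq0 : forall n, Z n x y != 0.

(** Each use of [Eoff_rec] lowers the size and raises the Taylor index by one, until [Eoff1] ends
    the iteration. *)
Lemma Eoff_telescope n i :
  Eoff n.+1 i = Z n x y * \sum_(0 <= t < n)
    (y ^+ t.+1 * 'C(n + i, i + t.+1)%:R ^+ 2 +
     (x * y ^+ t * refined_sum (n - t) (i + t) ^+ 2 -
      y ^+ t.+1 * refined_sum (n - t) (i + t.+1) ^+ 2) / (Z (n - t) x y * Z (n - t - 1) x y)).
Proof.
elim: n i => [|n IH] i; first by rewrite big_geq // mulr0 Eoff1.
apply: (mulIf (Z_neq0 n)); rewrite Eoff_rec IH big_nat_recl //=.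
rewrite subn0 subn1 /= !addn0 addn1 expr1 expr0 mulr1.
set S1 := \sum_(0 <= t < n) _; set S2 := \sum_(0 <= t < n) _.
have -> : S2 = y * S1.
  rewrite mulr_sumr; apply: eq_bigr => t _.
  rewrite !subSS !addSnnS !exprS; ring.
by rewrite addnS -addSn; field; rewrite !Z_neq0.
Qed.

Lemma Z_recurrence n : (2 <= n)%N ->
  Z n x y = Z (n - 1) x y * (1 + \sum_(0 <= i < n - 1)
      (y ^+ i.+1 * 'C(n - 1, i.+1)%:R ^+ 2 +
       (x * y ^+ i *
          (\sum_(0 <= j < n - i - 1)
             'C(n - j - 2, i)%:R * Zcoef (n - i - 1) x y j) ^+ 2
        - y ^+ i.+1 *
          (\sum_(0 <= j < n - i - 1)
             'C(n - j - 1, i.+1)%:R * Zcoef (n - i - 1) x y j) ^+ 2)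
       / (Z (n - i - 1) x y * Z (n - i - 2) x y))).
Proof.
case: n => [|n] // _; rewrite subn1 /=.
have := Eoff_telescope n 0; rewrite Eoff0 => /(canRL (subrK _)) ->.
rewrite mulrDr mulr1 addrC; congr (_ + _ * _); apply: eq_big_nat => t /andP[_ lt_tn].
have nE : (n.+1 - t - 1 = n - t)%N by lia.
rewrite addn0 !add0n nE -[(n.+1 - t - 2)%N]/(_) (_ : (n.+1 - t - 2 = n - t - 1)%N); last by lia.
have rs1 k : refined_sum (n - t) k = \sum_(0 <= j < n - t) 'C(n - t - j.+1 + k, k)%:R * Zcoef (n - t) x y j.
  by rewrite big_mkord; apply: eq_bigr => j _; rewrite mulrC.
rewrite !rs1; congr (_ + (_ * _ ^+ 2 - _ * _ ^+ 2) / _); apply: eq_big_nat => j /andP[_ lt_j].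
  by congr ('C(_, _)%:R * _); lia.
by congr ('C(_, _)%:R * _); lia.
Qed.

End CoefficientRecurrence.

(** * From the parameters r and s to the indeterminates x and y *)

Lemma quadratic_root_extension (K : fieldType) (b c : K) :
  exists (L : fieldType) (f : {rmorphism K -> L}) (t : L), t ^+ 2 - f b * t + f c = 0.
Proof.
pose p : {poly K} := 'X^2 - b *: 'X + c%:P.
have szp : size p = 3%N.
  rewrite /p -addrA size_polyDl size_polyXn //.
  apply: leq_ltn_trans (size_polyD _ _) _; rewrite gtn_max size_polyN.
  rewrite (leq_ltn_trans (size_scale_leq _ _)) ?size_polyX //.
  exact: leq_ltn_trans (size_polyC_leq1 _) _.
have rootE (L : fieldType) (f : {rmorphism K -> L}) (t : L) : root (map_poly f p) t ->
    t ^+ 2 - f b * t + f c = 0.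
  rewrite /p rootE !(rmorphD, rmorphN) /= map_polyXn map_polyZ map_polyX map_polyC.
  by rewrite !hornerE => /eqP.
(* A quadratic polynomial without a root is irreducible, and then a root can be adjoined. *)
have [irr|[t pt]] : irreducible_poly p \/ exists t, root p t.
  have [[t pt]|none] := Classical_Prop.classic (exists t, root p t); first by right; exists t.
  by left; apply: cubic_irreducible; rewrite ?szp // => t; apply/negP => pt; apply: none; exists t.
- have [L _ [t pt _]] := irredp_FAdjoin irr.
  by exists L, (in_alg L), t; apply: rootE.
exists K, idfun, t; apply: rootE.
by rewrite map_poly_id.
Qed.

Lemma card_ASM_gt0 n : (0 < #|ASM n|)%N.
Proof.
apply/card_gt0P; exists (\matrix_(i, j) entry (i == j)%:Z); rewrite mem_ASM.
set A := \matrix_(i, j) _.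
have fE i j : (i < n)%N -> (j < n)%N -> mxf A i j = (i == j)%:Z.
  move=> lt_in lt_jn; rewrite -[i]/(val (Ordinal lt_in)) -[j]/(val (Ordinal lt_jn)) mxf_ord mxE.
  by rewrite entryK //; case: eqP.
have sumE i k : (i < n)%N -> (k <= n)%N -> \sum_(j < k) mxf A i j = (i < k)%N%:Z.
  move=> lt_in; elim: k => [|k IH] lt_kn; first by rewrite big_ord0.
  rewrite big_ord_recr /= IH ?(ltnW lt_kn) // fE // (ltnS i).
  by case: (ltngtP i k).
have symA i j : mxf A i j = mxf A j i.
  rewrite -mxf_tr; congr (mxf _ _ _); apply/matrixP => k l; rewrite !mxE eq_sym.
  by [].
have rows : asm_lines n (mxf A).
  apply/forallP => i; rewrite sumE // ltn_ord eqxx andbT; apply/forallP => k.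
  by rewrite sumE //; case: (_ < _)%N.
rewrite rows /=; apply/forallP => i; have /forallP/(_ i) := rows.
by congr (_ && _); [apply: eq_forallb => k; congr is01|congr (_ == _)]; apply: eq_bigr => j _.
Qed.

(** At x = y = 1 the generating function counts the alternating sign matrices, and there is at least
    one. *)
Lemma Z_indet_neq0 n : Z n indet_x indet_y != 0.
Proof.
pose phi : {rmorphism {mpoly int[2]} -> ratfun} := @tofrac {mpoly int[2]}.
have -> : Z n indet_x indet_y = phi (Z n 'X_0 'X_1) by rewrite Z_morph.
have phi_eq0 p : (phi p == 0) = (p == 0) by apply: tofrac_eq0.
rewrite phi_eq0; pose ev : {rmorphism {mpoly int[2]} -> int} := meval (fun=> 1).
apply: contraNneq (_ : ev (Z n 'X_0 'X_1) != 0) => [->|]; first by rewrite rmorph0.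
rewrite Z_morph /= !mevalXU -Zadj11 /Zadj (eq_bigr (fun=> 1)) => [|A _].
  by rewrite sumr_const pnatr_eq0 -lt0n card_ASM_gt0.
by rewrite /asm_weight !expr1n !mulr1.
Qed.

(* [r] and [s] are the roots of [t ^ 2 - (1 + x - y) t + x] in an extension of [K]. *)
Lemma Z_recurrence_field (K : fieldType) (x y : K) n :
  x != 0 -> y != 0 -> (1 + x - y) ^+ 2 - x *+ 4 != 0 -> (forall m, Z m x y != 0) ->
  (2 <= n)%N ->
  Z n x y =
    Z (n - 1) x y *
    (1 + \sum_(0 <= i < n - 1)
      (y ^+ i.+1 * 'C(n - 1, i.+1)%:R ^+ 2 +
       (x * y ^+ i *
          (\sum_(0 <= j < n - i - 1)
             'C(n - j - 2, i)%:R * Zcoef (n - i - 1) x y j) ^+ 2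
        - y ^+ i.+1 *
          (\sum_(0 <= j < n - i - 1)
             'C(n - j - 1, i.+1)%:R * Zcoef (n - i - 1) x y j) ^+ 2)
       / (Z (n - i - 1) x y * Z (n - i - 2) x y))).
Proof.
move=> x0 y0 disc Zxy hn.
have [L [f [r er]]] := quadratic_root_extension (1 + x - y) x.
pose s := f (1 + x - y) - r.
have ex : r * s = f x.
  by apply/eqP; rewrite -subr_eq0 -oppr_eq0 -er /s; apply/eqP; ring.
have ey : (1 - r) * (1 - s) = f y.
  have -> : (1 - r) * (1 - s) = 1 - (r + s) + r * s by ring.
  by rewrite ex /s addrC [r + _]addrC subrK !(rmorphB, rmorphD) rmorph1; ring.
have f0 t : t != 0 -> f t != 0 by rewrite fmorph_eq0.
have rs0 : r * s != 0 by rewrite ex; apply: f0.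
have rs1 : (1 - r) * (1 - s) != 0 by rewrite ey; apply: f0.
have [r0 s0] : r != 0 /\ s != 0.
  by move: rs0; rewrite mulf_eq0 negb_or => /andP.
have [r1 s1] : 1 - r != 0 /\ 1 - s != 0.
  by move: rs1; rewrite mulf_eq0 negb_or => /andP.
(* The discriminant of the quadratic is [(r - s) ^+ 2]. *)
have rs : r - s != 0.
  have := f0 _ disc; apply: contraNneq => e.
  have -> : f ((1 + x - y) ^+ 2 - x *+ 4) = (r - s) ^+ 2.
    rewrite rmorphB rmorphXn rmorphMn -ex /s; ring.
  by rewrite e expr0n.
have Zn0 m : Z m (r * s) ((1 - r) * (1 - s)) != 0.
  by rewrite ex ey -Z_morph; apply: f0.
have := Z_recurrence r0 s0 r1 s1 rs Zn0 hn; rewrite ex ey => rec.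
apply: (fmorph_inj f).
have fZ m : f (Z m x y) = Z m (f x) (f y) by exact: Z_morph.
have fZc m k : f (Zcoef m x y k) = Zcoef m (f x) (f y) k.
  by rewrite /Zcoef -Zref_morph coef_map.
rewrite fZ rec rmorphM fZ rmorphD rmorph1 rmorph_sum; congr (_ * (_ + _)).
apply: eq_bigr => i _.
have fS m (c : nat -> nat) : f (\sum_(0 <= j < m) (c j)%:R * Zcoef m x y j) =
    \sum_(0 <= j < m) (c j)%:R * Zcoef m (f x) (f y) j.
  by rewrite rmorph_sum; apply: eq_bigr => j _; rewrite rmorphM rmorph_nat fZc.
by rewrite rmorphD fmorph_div rmorphB !rmorphM !rmorphXn rmorph_nat !fS !fZ.
Qed.

Theorem corollary9 (n : nat) (hn : (2 <= n)%N) :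
  let x := indet_x in
  let y := indet_y in
  Z n x y =
    Z (n - 1) x y *
    (1 + \sum_(0 <= i < n - 1)
      (y ^+ i.+1 * 'C(n - 1, i.+1)%:R ^+ 2 +
       (x * y ^+ i *
          (\sum_(0 <= j < n - i - 1)
             'C(n - j - 2, i)%:R * Zcoef (n - i - 1) x y j) ^+ 2
        - y ^+ i.+1 *
          (\sum_(0 <= j < n - i - 1)
             'C(n - j - 1, i.+1)%:R * Zcoef (n - i - 1) x y j) ^+ 2)
       / (Z (n - i - 1) x y * Z (n - i - 2) x y))).
Proof.
move=> x y.
pose phi : {rmorphism {mpoly int[2]} -> ratfun} := @tofrac {mpoly int[2]}.
have phi_eq0 p : (phi p == 0) = (p == 0) by apply: tofrac_eq0.
have neq0 (p : {mpoly int[2]}) (a : 'I_2 -> int) : p.@[a] != 0 -> phi p != 0.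
  by rewrite phi_eq0; apply: contraNneq => ->; rewrite meval0.
have x0 : x != 0 by apply: (neq0 'X_0 (fun=> 1)); rewrite mevalXU.
have y0 : y != 0 by apply: (neq0 'X_1 (fun=> 1)); rewrite mevalXU.
have disc : (1 + x - y) ^+ 2 - x *+ 4 != 0.
  (* The discriminant takes the value 1 at x = y = 0. *)
  have := neq0 ((1 + 'X_0 - 'X_1) ^+ 2 - 'X_0 *+ 4) (fun=> 0).
  rewrite !(rmorphB, rmorphD, rmorphXn, rmorphMn, rmorph1) /= !mevalXU.
  by apply.
exact: Z_recurrence_field x0 y0 disc Z_indet_neq0 hn.
Qed.
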